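(* (1) The set $\mathrm{ASTR}\cdot\exp(\mathbb{Q}f_1)=\{\varphi\cdot\exp(cf_1)\mid \varphi\in\mathrm{ASTR},\,c\in\mathbb{Q}\}$ is equal to the set of series $g\in\exp\hat{\mathfrak f}_2^{\dagger}$ for which there exists a commutator group-like series $h\in\widehat{U\mathfrak f_2}$ such that $$\mathrm{flip}(g^{0,1,2}g^{0,12,3})=g^{0,1,2}g^{0,12,3}\cdot h^{1,2,3}\quad\text{in }\widehat{U\mathfrak t_4},$$ or equivalently $$g^{01,2,3}g^{0,1,23}=g^{0,1,2}g^{0,12,3}\cdot h^{1,2,3}.$$ (2) The $\mathbb{Q}$-linear space $\mathfrak{grt}_1+\mathbb{Q}f_1$ is equal to the set of series $\alpha\in\hat{\mathfrak f}_2^{\dagger}$ for which there exists a commutator Lie-like series $\beta\in\hat{\mathfrak f}_2$ such that $$\mathrm{flip}(\alpha^{0,1,2}+\alpha^{0,12,3})=\alpha^{0,1,2}+\alpha^{0,12,3}+\beta^{1,2,3},$$ or equivalently $$\alpha^{01,2,3}+\alpha^{0,1,23}=\alpha^{0,1,2}+\alpha^{0,12,3}+\beta^{1,2,3}.$$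
   Context: $\mathfrak f_2$ is the free Lie algebra over $\mathbb{Q}$ on $f_0,f_1$; $\hat{\mathfrak f}_2$ is its completion by degree and $\widehat{U\mathfrak f_2}=\mathbb{Q}\langle\langle f_0,f_1\rangle\rangle$ the completed enveloping algebra, with the coproduct $\Delta$ making $f_0,f_1$ primitive. $\exp\hat{\mathfrak f}_2$ is the set of group-like series. $\hat{\mathfrak f}_2^{\dagger}$ (resp. $\exp\hat{\mathfrak f}_2^{\dagger}$) is the set of elements of $\hat{\mathfrak f}_2$ (resp. $\exp\hat{\mathfrak f}_2$) whose coefficient of $f_0$ is zero. A series is commutator group-like (resp. commutator Lie-like) if it lies in $\exp[\hat{\mathfrak f}_2,\hat{\mathfrak f}_2]$ (resp. in $[\hat{\mathfrak f}_2,\hat{\mathfrak f}_2]$), the commutators being topological. $\mathfrak t_4$ is the Lie algebra over $\mathbb{Q}$ generated by $t_{ij}$ ($0\le i,j<4$) with relations $t_{ii}=0$, $t_{ij}=t_{ji}$, $[t_{ij},t_{ik}+t_{jk}]=0$, $[t_{ij},t_{kl}]=0$ for distinct $i,j,k,l\in\{0,1,2,3\}$; $\widehat{U\mathfrak t_4}$ is the degree completion of its enveloping algebra. For $\varphi=\varphi(f_0,f_1)\in\widehat{U\mathfrak f_2}$ and disjoint subsets $S_0,S_1,S_2\subset\{0,1,2,3\}$, put $\varphi^{S_0,S_1,S_2}=\varphi\bigl(\sum_{(i,j)\in S_0\times S_1}t_{ij},\sum_{(j,k)\in S_1\times S_2}t_{jk}\bigr)\in\widehat{U\mathfrak t_4}$;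 subsets are written by juxtaposition, e.g. $\varphi^{01,2,3}$ means $S_0=\{0,1\},S_1=\{2\},S_2=\{3\}$. $\mathrm{flip}$ is the involutive continuous algebra automorphism of $\widehat{U\mathfrak t_4}$ with $t_{ij}\mapsto t_{4-i,4-j}$ for $1\le i<j\le 3$ and $t_{0j}\mapsto-\sum_{k=0}^{3}t_{k,4-j}$ for $1\le j\le3$. $\mathrm{ASTR}$ is the set of $\varphi\in\exp\hat{\mathfrak f}_2$ satisfying the pentagon equation $\varphi^{01,2,3}\varphi^{0,1,23}=\varphi^{0,1,2}\varphi^{0,12,3}\varphi^{1,2,3}$ in $\widehat{U\mathfrak t_4}$. $\mathfrak{grt}_1$ is the set of $\psi\in\hat{\mathfrak f}_2$ satisfying $\psi^{01,2,3}+\psi^{0,1,23}=\psi^{0,1,2}+\psi^{0,12,3}+\psi^{1,2,3}$ in the completion of $\mathfrak t_4$. *)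

(* Defs.v *)
(* MathComp, with classical logic from mathcomp-classical. *)
From HB Require Import structures.
From mathcomp Require Import all_boot all_order all_algebra.
From mathcomp Require Import boolp classical_sets.

Set Implicit Arguments.
Unset Strict Implicit.
Unset Printing Implicit Defensive.

Import GRing.Theory.
Local Open Scope ring_scope.

(** * Noncommutative formal power series over the rationals *)

(* Q<<A>>, a series being the function giving the coefficient of each word.  *)
Definition ncseries (A : Type) : Type := seq A -> rat.

HB.instance Definition _ (A : Type) := gen_eqMixin (ncseries A).
HB.instance Definition _ (A : Type) := gen_choiceMixin (ncseries A).

Section NCSeriesRing.
Variable A : Type.
Implicit Types (f g h : ncseries A) (c : rat) (w : seq A).

Definition ncadd f g : ncseries A := fun w => f w + g w.
Definition ncopp f : ncseries A := fun w => - f w.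
Definition nczero : ncseries A := fun=> 0.
Definition ncscale c f : ncseries A := fun w => c * f w.
Definition ncone : ncseries A := fun w => (nilp w)%:R.
Definition ncmul f g : ncseries A :=
  fun w => \sum_(i < (size w).+1) f (take i w) * g (drop i w).

Fact ncaddA : associative ncadd.
Proof. by move=> f g h; apply: funext => w; exact: addrA. Qed.
Fact ncaddC : commutative ncadd.
Proof. by move=> f g; apply: funext => w; exact: addrC. Qed.
Fact ncadd0 : left_id nczero ncadd.
Proof. by move=> f; apply: funext => w; exact: add0r. Qed.
Fact ncaddN : left_inverse nczero ncopp ncadd.
Proof. by move=> f; apply: funext => w; exact: addNr. Qed.

HB.instance Definition _ :=
  GRing.isZmodule.Build (ncseries A) ncaddA ncaddC ncadd0 ncaddN.

Lemma ncmul_nil f g : ncmul f g [::] = f [::] * g [::].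
Proof. by rewrite /ncmul big_ord1. Qed.

Lemma ncmul_cons f g x w :
  ncmul f g (x :: w) = f [::] * g (x :: w) + ncmul (fun v => f (x :: v)) g w.
Proof. by rewrite /ncmul big_ord_recl. Qed.

Fact ncmulDl : left_distributive ncmul +%R.
Proof.
move=> f g h; apply: funext => w; rewrite /ncmul /GRing.add /= /ncadd.
by rewrite -big_split; apply: eq_bigr => i _; exact: mulrDl.
Qed.

Fact ncmulDr : right_distributive ncmul +%R.
Proof.
move=> f g h; apply: funext => w; rewrite /ncmul /GRing.add /= /ncadd.
by rewrite -big_split; apply: eq_bigr => i _; exact: mulrDr.
Qed.

Fact ncscaleAl c f g : ncscale c (ncmul f g) = ncmul (ncscale c f) g.
Proof.
apply: funext => w; rewrite /ncmul /ncscale mulr_sumr.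
by apply: eq_bigr => i _; rewrite mulrA.
Qed.

Fact ncscaleAr c f g : ncscale c (ncmul f g) = ncmul f (ncscale c g).
Proof.
apply: funext => w; rewrite /ncmul /ncscale mulr_sumr.
by apply: eq_bigr => i _; rewrite mulrCA.
Qed.

Fact ncmulA : associative ncmul.
Proof.
move=> f g h; apply: funext => w.
elim: w f g h => [|x w IH] f g h; first by rewrite !ncmul_nil mulrA.
rewrite !ncmul_cons IH ncmul_nil.
have -> : (fun v => ncmul f g (x :: v)) =
    ncscale (f [::]) (fun v => g (x :: v)) + ncmul (fun v => f (x :: v)) g.
  by apply: funext => v; rewrite ncmul_cons.
by rewrite ncmulDl -ncscaleAl mulrDr mulrA -addrA.
Qed.

Fact ncmul1 : left_id ncone ncmul.
Proof.
move=> f; apply: funext => w; rewrite /ncmul big_ord_recl take0 drop0 mul1r.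
rewrite big1 ?addr0 // => i _; rewrite /ncone.
by case: w i => [|x w] i /=; [case: i | rewrite mul0r].
Qed.

Fact ncmul1r : right_id ncone ncmul.
Proof.
move=> f; apply: funext => w; elim: w f => [|x w IH] f.
  by rewrite ncmul_nil mulr1.
by rewrite ncmul_cons mulr0 add0r IH.
Qed.

Fact ncone_neq0 : ncone != 0.
Proof.
apply/eqP => /(congr1 (fun f : ncseries A => f [::])) /eqP.
by rewrite /ncone /= oner_eq0.
Qed.

HB.instance Definition _ := GRing.Zmodule_isNzRing.Build (ncseries A)
  ncmulA ncmul1 ncmul1r ncmulDl ncmulDr ncone_neq0.

Fact ncscaleA c d f : ncscale c (ncscale d f) = ncscale (c * d) f.
Proof. by apply: funext => w; exact: mulrA. Qed.
Fact ncscale1 : left_id 1 ncscale.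
Proof. by move=> f; apply: funext => w; exact: mul1r. Qed.
Fact ncscaleDr : right_distributive ncscale +%R.
Proof. by move=> c f g; apply: funext => w; exact: mulrDr. Qed.
Fact ncscaleDl f : {morph ncscale^~ f : c d / c + d}.
Proof. by move=> c d; apply: funext => w; exact: mulrDl. Qed.

HB.instance Definition _ := GRing.Zmodule_isLmodule.Build rat (ncseries A)
  ncscaleA ncscale1 ncscaleDr ncscaleDl.
HB.instance Definition _ :=
  GRing.Lmodule_isLalgebra.Build rat (ncseries A) ncscaleAl.
HB.instance Definition _ :=
  GRing.Lalgebra_isAlgebra.Build rat (ncseries A) ncscaleAr.

End NCSeriesRing.

Definition letter (A : eqType) (a : A) : ncseries A := fun w => (w == [:: a])%:R.

Definition lie (A : Type) (x y : ncseries A) : ncseries A := x * y - y * x.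

(* The sum of x ^+ n / n`! over all n. It is meant for x without constant    *)
(* term, when the terms n > size w do not contribute to the coefficient of w. *)
Definition ncexp (A : Type) (x : ncseries A) : ncseries A :=
  fun w => \sum_(n < (size w).+1) (n`!%:R)^-1 * (x ^+ n) w.

(* The continuous algebra morphism Q<<A>> -> Q<<B>> sending each letter a to *)
(* s a. It is meant for s without constant terms, when only words of length  *)
(* at most size v contribute to the coefficient of v.                        *)
Definition ncsubst (A : finType) (B : Type) (s : A -> ncseries B)
    (phi : ncseries A) : ncseries B :=
  fun v => \sum_(n < (size v).+1) \sum_(w : n.-tuple A)
             phi w * (\prod_(a <- w) s a) v.

(* Closure for the degree topology. If S is a graded subspace of Q<A>, this  *)
(* is its completion by degree, inside Q<<A>>.                               *)
Definition nc_closure (A : Type) (S : ncseries A -> Prop) (x : ncseries A) :=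
  forall n, exists2 y, S y & forall w, (size w <= n)%N -> x w = y w.

(** * Free Lie algebra and group-like series *)

(* The free Lie algebra on A, realized as the Lie subalgebra of Q<A>         *)
(* generated by the letters.                                                 *)
Inductive lie_poly (A : eqType) : ncseries A -> Prop :=
| LiePoly0 : lie_poly 0
| LiePolyLetter a : lie_poly (letter a)
| LiePolyD x y : lie_poly x -> lie_poly y -> lie_poly (x + y)
| LiePolyZ c x : lie_poly x -> lie_poly (c *: x)
| LiePolyLie x y : lie_poly x -> lie_poly y -> lie_poly (lie x y).

Definition lie_series (A : eqType) : ncseries A -> Prop :=
  nc_closure (@lie_poly A).

(* The terms u (x) v of the coproduct of the word w, with multiplicity: the  *)
(* expansion of the product of the x (x) 1 + 1 (x) x over the letters x of w. *)
Fixpoint unshuffles (A : Type) (w : seq A) : seq (seq A * seq A) :=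
  if w is x :: w' then
    [seq (x :: p.1, p.2) | p <- unshuffles w'] ++
    [seq (p.1, x :: p.2) | p <- unshuffles w']
  else [:: ([::], [::])].

(* Coefficient of u (x) v in the coproduct of phi.                           *)
Definition coproduct (A : finType) (phi : ncseries A) (u v : seq A) : rat :=
  \sum_(w : (size u + size v).-tuple A)
     phi w * (count_mem (u, v) (unshuffles w))%:R.

Definition grouplike (A : finType) (phi : ncseries A) : Prop :=
  phi [::] = 1 /\ forall u v, coproduct phi u v = phi u * phi v.

(** * The free Lie algebra f_2 *)

(* The letters false and true of bool are the indices of f_0 and f_1.        *)
Definition f0 : ncseries bool := letter false.
Definition f1 : ncseries bool := letter true.

Definition f2_hat : set (ncseries bool) := [set psi | lie_series psi].
Definition exp_f2_hat : set (ncseries bool) := [set phi | grouplike phi].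

Definition f2_hat_dagger : set (ncseries bool) :=
  [set psi | f2_hat psi /\ psi [:: false] = 0].
Definition exp_f2_hat_dagger : set (ncseries bool) :=
  [set phi | exp_f2_hat phi /\ phi [:: false] = 0].

(* The topological commutator [f2_hat, f2_hat]: closure of the linear span   *)
(* of the brackets (scalars are absorbed in the brackets).                   *)
Definition commutator_lielike : set (ncseries bool) :=
  [set psi | f2_hat psi /\
     nc_closure (fun x => exists2 s : seq (ncseries bool * ncseries bool),
       (forall p, p \in s -> f2_hat p.1 /\ f2_hat p.2) &
       x = \sum_(p <- s) lie p.1 p.2) psi].

Definition commutator_grouplike : set (ncseries bool) :=
  [set h | exists2 psi, commutator_lielike psi & h = ncexp psi].

(** * The Lie algebra t_4 and its enveloping algebra *)

(* Elements of the completions of t_4 and of U(t_4) are represented by       *)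
(* series in the free letters t i j, i, j < 4.                               *)
Definition t4_letter := ('I_4 * 'I_4)%type.
Definition t (i j : 'I_4) : ncseries t4_letter := letter (i, j).

Inductive t4_relator : ncseries t4_letter -> Prop :=
| T4Diag i : t4_relator (t i i)
| T4Sym i j : t4_relator (t i j - t j i)
| T4Triple i j k : uniq [:: i; j; k] ->
    t4_relator (lie (t i j) (t i k + t j k))
| T4Disjoint i j k l : uniq [:: i; j; k; l] ->
    t4_relator (lie (t i j) (t k l)).

(* Two-sided ideal generated by the relators.                                *)
Inductive Ut4_ideal : ncseries t4_letter -> Prop :=
| Ut4Ideal0 : Ut4_ideal 0
| Ut4IdealRel a r b : t4_relator r -> Ut4_ideal (a * r * b)
| Ut4IdealD x y : Ut4_ideal x -> Ut4_ideal y -> Ut4_ideal (x + y).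

(* Lie ideal, of the free Lie algebra, generated by the relators.            *)
Inductive t4_ideal : ncseries t4_letter -> Prop :=
| T4Ideal0 : t4_ideal 0
| T4IdealRel r : t4_relator r -> t4_ideal r
| T4IdealD x y : t4_ideal x -> t4_ideal y -> t4_ideal (x + y)
| T4IdealZ c x : t4_ideal x -> t4_ideal (c *: x)
| T4IdealLie x y : lie_poly x -> t4_ideal y -> t4_ideal (lie x y).

Definition Ut4_closed_ideal : {pred ncseries t4_letter} :=
  fun x => `[< nc_closure Ut4_ideal x >].
Definition t4_closed_ideal : {pred ncseries t4_letter} :=
  fun x => `[< nc_closure t4_ideal x >].

Lemma nc_closure_zmod (A : Type) (S : ncseries A -> Prop) :
  S 0 -> (forall x y, S x -> S y -> S (x - y)) ->
  zmod_closed (fun x => `[< nc_closure S x >]).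
Proof.
move=> S0 SB; split; first by apply/asboolP => n; exists 0.
move=> x y /asboolP Sx /asboolP Sy; apply/asboolP => n.
have [x' Sx' xx'] := Sx n; have [y' Sy' yy'] := Sy n.
by exists (x' - y') => [|w lew]; [exact: SB | congr (_ - _); auto].
Qed.

Fact Ut4_closed_ideal_zmod : zmod_closed Ut4_closed_ideal.
Proof.
apply: nc_closure_zmod => [|x y Ix Iy]; first exact: Ut4Ideal0.
apply: Ut4IdealD => //; elim: Iy => {y} [|a r b rr|y z _ IHy _ IHz].
- by rewrite oppr0; exact: Ut4Ideal0.
- by rewrite -!mulNr; exact: Ut4IdealRel.
- by rewrite opprD; exact: Ut4IdealD.
Qed.

Fact t4_closed_ideal_zmod : zmod_closed t4_closed_ideal.
Proof.
apply: nc_closure_zmod => [|x y Ix Iy]; first exact: T4Ideal0.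
by apply: T4IdealD => //; rewrite -scaleN1r; exact: T4IdealZ.
Qed.

HB.instance Definition _ :=
  GRing.isZmodClosed.Build _ Ut4_closed_ideal Ut4_closed_ideal_zmod.
HB.instance Definition _ :=
  GRing.isZmodClosed.Build _ t4_closed_ideal t4_closed_ideal_zmod.

(* The completion of U(t_4): U(t_4) is the associative algebra with the same *)
(* generators and relations as t_4. An identity between products of elements *)
(* of the completion is written as  x = y %[mod Ut4_hat]  on representatives. *)
Definition Ut4_hat := Quotient.quot Ut4_closed_ideal.

(* The completion of t_4 consists of the classes of the Lie series.          *)
Definition t4_hat := Quotient.quot t4_closed_ideal.

(** * Evaluation on strands, and the flip *)

Definition cable (S0 S1 S2 : {set 'I_4}) (phi : ncseries bool) :
    ncseries t4_letter :=
  ncsubst (fun b : bool =>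
    if b then \sum_(j in S1) \sum_(k in S2) t j k
    else \sum_(i in S0) \sum_(j in S1) t i j) phi.

Notation "phi ^{ S0 , S1 , S2 }" := (cable S0 S1 S2 phi)
  (at level 2, S0, S1, S2 at level 99, left associativity,
   format "phi ^{ S0 ,  S1 ,  S2 }") : ring_scope.

Definition s0 : {set 'I_4} := [set inord 0]%SET.
Definition s1 : {set 'I_4} := [set inord 1]%SET.
Definition s2 : {set 'I_4} := [set inord 2]%SET.
Definition s3 : {set 'I_4} := [set inord 3]%SET.
Definition s01 : {set 'I_4} := [set inord 0; inord 1]%SET.
Definition s12 : {set 'I_4} := [set inord 1; inord 2]%SET.
Definition s23 : {set 'I_4} := [set inord 2; inord 3]%SET.

(* j |-> 4 - j, used for j <> 0 only.                                        *)
Definition rev4 (j : 'I_4) : 'I_4 := inord (4 - j).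

(* The values on t i j with i > j or i = j are forced by t i j = t j i and   *)
(* t i i = 0.                                                                *)
Definition flip_letter (p : t4_letter) : ncseries t4_letter :=
  let: (i, j) := p in
  match i == inord 0, j == inord 0 with
  | false, false => t (rev4 i) (rev4 j)
  | true, false => - \sum_(k < 4) t k (rev4 j)
  | false, true => - \sum_(k < 4) t k (rev4 i)
  | true, true => 0
  end.

(* The flip, on representatives: it preserves both closed ideals above.      *)
Definition flip : ncseries t4_letter -> ncseries t4_letter :=
  ncsubst flip_letter.

(** * Associators and the Lie algebra grt_1 *)

Local Open Scope quotient_scope.

Definition ASTR : set (ncseries bool) :=
  [set phi | exp_f2_hat phi /\
     phi^{s01, s2, s3} * phi^{s0, s1, s23}
     = phi^{s0, s1, s2} * phi^{s0, s12, s3} * phi^{s1, s2, s3} %[mod Ut4_hat]].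

Definition grt1 : set (ncseries bool) :=
  [set psi | f2_hat psi /\
     psi^{s01, s2, s3} + psi^{s0, s1, s23}
     = psi^{s0, s1, s2} + psi^{s0, s12, s3} + psi^{s1, s2, s3} %[mod t4_hat]].

(* Main.v *)
Require Import Defs.
From mathcomp Require Import all_boot all_order all_algebra.
From mathcomp Require Import boolp classical_sets.
From mathcomp Require Import ring lra.

Set Implicit Arguments.
Unset Strict Implicit.
Unset Printing Implicit Defensive.

Import GRing.Theory.
Local Open Scope ring_scope.
Local Open Scope quotient_scope.
Local Open Scope classical_set_scope.

(** Write [Phi(g)] for the left-hand side [g^{01,2,3} g^{0,1,23}] and [Psi(g)]
    for [g^{0,1,2} g^{0,12,3}].

    The flip. On the arguments of the cablings, the flip agrees with the passage
    from [Psi] to [Phi] up to elements commuting with both arguments: it sends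
    [t01] to [(t02 + t12) - z] with [z = t02 + t12 + t03 + t13 + t23], which
    commutes with [t02 + t12] and with [t23], and [t01 + t02] to [t01 - z'] with
    [z'] commuting with [t01] and with [t12 + t13]. A Lie series only sees such
    a correction through its coefficient of [f0], which is zero for elements of
    [f2_hat_dagger]; hence [flip (Psi g) = Phi g], first for Lie series
    ([lie_series_shift], [flip_cables_lie]) and then for their exponentials
    ([flip_cables_grouplike]). So the flip equation and the equation
    [Phi(g) = Psi(g) h^{1,2,3}] are equivalent.

    The exponentials. If g solves [Phi(g) = Psi(g) h^{1,2,3}], so does
    [g exp(c f1)] with the same h ([pentagon_exp]). Indeed the factors
    [exp(c t23)] and [exp(c t12)] coming from the first cabling on each side
    commute with the second cabling, both sides collect the same factor
    [exp(c (t12 + t13 + t23))], and this commutes with [h^{1,2,3}].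

    The series h. Deleting strand 0 and killing the centre of the algebra of the
    remaining three strands yields the algebra of noncommutative series. Under
    this projection the equation becomes [g exp(- b f1) = h], with b the
    coefficient of [f1] in g ([pentagon_delete0]). Hence [g exp(- b f1)] solves
    the equation with itself in the role of h, which is the pentagon equation.
    Conversely, the linear part of an associator vanishes
    ([pentagon_linear]), so it is a commutator group-like series and may serve
    as h for all [phi exp(c f1)].

    All this uses that group-like series are exponentials of Lie series
    ([grouplike_exp]). The logarithm is built one degree at a time: if the
    exponential of a Lie polynomial agrees with a group-like series up to degree
    n, the difference is primitive in degree n + 1, and homogeneous primitive
    elements are Lie polynomials by Dynkin's identity ([dynkin_unshuffles]).

    The additive statement follows the same lines, with sums in place of
    products. *)

(** * Coefficients and orders of series *)

Section Coefficients.
Variable A : Type.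
Implicit Types (f g : ncseries A) (w : seq A).

Lemma nc0E w : (0 : ncseries A) w = 0. Proof. by []. Qed.
Lemma nc1E w : (1 : ncseries A) w = (nilp w)%:R. Proof. by []. Qed.
Lemma ncDE f g w : (f + g) w = f w + g w. Proof. by []. Qed.
Lemma ncNE f w : (- f) w = - f w. Proof. by []. Qed.
Lemma ncBE f g w : (f - g) w = f w - g w. Proof. by []. Qed.
Lemma ncZE c f w : (c *: f) w = c * f w. Proof. by []. Qed.
Lemma ncME f g w :
  (f * g) w = \sum_(i < (size w).+1) f (take i w) * g (drop i w).
Proof. by []. Qed.

Lemma ncM_nil f g : (f * g) [::] = f [::] * g [::].
Proof. exact: ncmul_nil. Qed.

Lemma ncM_letter f g x :
  (f * g) [:: x] = f [::] * g [:: x] + f [:: x] * g [::].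
Proof. by rewrite ncME !big_ord_recl big_ord0 addr0. Qed.

Lemma ncsumE I (r : seq I) (P : pred I) (F : I -> ncseries A) w :
  (\sum_(i <- r | P i) F i) w = \sum_(i <- r | P i) F i w.
Proof. exact: (big_morph (fun f : ncseries A => f w)). Qed.

End Coefficients.

Definition ncE := (nc0E, nc1E, ncDE, ncNE, ncZE).

(** Approximation in the degree topology is expressed by the order of a
    difference: [order_ge n (f - g)] says that f and g agree below degree n. *)
Definition order_ge A n (f : ncseries A) :=
  forall w, (size w < n)%N -> f w = 0.

Section Orders.
Variable A : Type.
Implicit Types (f g h x y : ncseries A) (w : seq A).

Lemma order_ge_eq0 f : (forall n, order_ge n f) -> f = 0.
Proof. by move=> f0; apply: funext => w; exact: (f0 (size w).+1). Qed.

Lemma order_ge_eq f g : (forall n, order_ge n (f - g)) -> f = g.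
Proof. by move=> fg; apply/subr0_eq/order_ge_eq0. Qed.

Lemma order_geW m n f : (m <= n)%N -> order_ge n f -> order_ge m f.
Proof. by move=> lemn fn w ltw; apply: fn; exact: leq_trans ltw lemn. Qed.

Lemma order_ge0 f : order_ge 0 f. Proof. by []. Qed.

Lemma order_ge1 f : f [::] = 0 -> order_ge 1 f.
Proof. by move=> f0 [|x w]. Qed.

Lemma order_geD n f g : order_ge n f -> order_ge n g -> order_ge n (f + g).
Proof. by move=> fn gn w ltw; rewrite ncDE fn ?gn ?addr0. Qed.

Lemma order_geN n f : order_ge n f -> order_ge n (- f).
Proof. by move=> fn w ltw; rewrite ncNE fn ?oppr0. Qed.

Lemma order_geB n f g : order_ge n f -> order_ge n g -> order_ge n (f - g).
Proof. by move=> fn gn; apply: order_geD => //; exact: order_geN. Qed.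

Lemma order_geZ n c f : order_ge n f -> order_ge n (c *: f).
Proof. by move=> fn w ltw; rewrite ncZE fn ?mulr0. Qed.

Lemma order_ge_sum n I (r : seq I) (P : pred I) (F : I -> ncseries A) :
  (forall i, P i -> order_ge n (F i)) ->
  order_ge n (\sum_(i <- r | P i) F i).
Proof.
by move=> Fn; elim/big_ind: _ => //; exact: order_geD.
Qed.

Lemma order_geM m n f g :
  order_ge m f -> order_ge n g -> order_ge (m + n) (f * g).
Proof.
move=> fm gn w ltw; rewrite ncME big1 // => i _.
have lei : (i <= size w)%N by rewrite -ltnS.
have [lti|gei] := ltnP i m.
  by rewrite fm ?mul0r // size_takel.
rewrite gn ?mulr0 // size_drop ltn_subLR //.
by apply: leq_trans ltw _; rewrite leq_add2r.
Qed.

Lemma order_geMl n f g : order_ge n g -> order_ge n (f * g).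
Proof. by move=> gn; rewrite -[n]add0n; exact: order_geM. Qed.

Lemma order_geMr n f g : order_ge n f -> order_ge n (f * g).
Proof. by move=> fn; rewrite -[n]addn0; exact: order_geM. Qed.

Lemma order_geX n f : f [::] = 0 -> order_ge n (f ^+ n).
Proof.
move=> f0; elim: n => // n IH; rewrite exprS -add1n.
by apply: order_geM => //; exact: order_ge1.
Qed.

Lemma order_ge_trans n f g h :
  order_ge n (f - g) -> order_ge n (g - h) -> order_ge n (f - h).
Proof. by move=> fg gh; rewrite -(subrKA g); exact: order_geD. Qed.

Lemma order_ge_sym n f g : order_ge n (f - g) -> order_ge n (g - f).
Proof. by move=> fg; rewrite -opprB; exact: order_geN. Qed.

Lemma order_ge_mul n f f' g g' :
  order_ge n (f - f') -> order_ge n (g - g') ->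
  order_ge n (f * g - f' * g').
Proof.
move=> ff gg; rewrite -(subrKA (f' * g)) -mulrBl -mulrBr.
by apply: order_geD; [exact: order_geMr | exact: order_geMl].
Qed.

Lemma order_ge_exp n f g k :
  order_ge n (f - g) -> order_ge n (f ^+ k - g ^+ k).
Proof.
move=> fg; elim: k => [|k IH]; first by rewrite subrr.
by rewrite !exprS; exact: order_ge_mul.
Qed.

Lemma nc_closureP (S : ncseries A -> Prop) x :
  nc_closure S x <-> forall n, exists2 y, S y & order_ge n (x - y).
Proof.
split=> Sx n.
  have [y Sy xy] := Sx n; exists y => // w ltw.
  by rewrite ncBE xy ?subrr // ltnW.
have [y Sy xy] := Sx n.+1; exists y => // w lew.
by apply/eqP; rewrite -subr_eq0; apply/eqP; exact: xy.
Qed.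

Lemma lie_nil f g : lie f g [::] = 0.
Proof. by rewrite /lie ncBE !ncM_nil mulrC subrr. Qed.

Lemma lie_letter f g a : f [::] = 0 -> g [::] = 0 -> lie f g [:: a] = 0.
Proof.
by move=> f0 g0; rewrite /lie ncBE !ncM_letter f0 g0 !(mul0r, mulr0, addr0) ?subrr.
Qed.

Lemma lieDl f g h : lie (f + g) h = lie f h + lie g h.
Proof. by rewrite /lie mulrDl mulrDr opprD addrACA. Qed.

Lemma lieC f g : lie f g = - lie g f.
Proof. by rewrite /lie opprB. Qed.

Lemma lieDr f g h : lie f (g + h) = lie f g + lie f h.
Proof. by rewrite lieC lieDl opprD -!lieC. Qed.

Lemma lieZl c f g : lie (c *: f) g = c *: lie f g.
Proof. by rewrite /lie -scalerAl -scalerAr scalerBr. Qed.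

Lemma lieZr c f g : lie f (c *: g) = c *: lie f g.
Proof. by rewrite lieC lieZl -scalerN -lieC. Qed.

Lemma lieNl f g : lie (- f) g = - lie f g.
Proof. by rewrite -scaleN1r lieZl scaleN1r. Qed.

Lemma lieNr f g : lie f (- g) = - lie f g.
Proof. by rewrite -scaleN1r lieZr scaleN1r. Qed.

Lemma lieBl f g h : lie (f - g) h = lie f h - lie g h.
Proof. by rewrite lieDl lieNl. Qed.

Lemma lieBr f g h : lie f (g - h) = lie f g - lie f h.
Proof. by rewrite lieDr lieNr. Qed.

Lemma lie0l f : lie 0 f = 0. Proof. by rewrite /lie mul0r mulr0 subrr. Qed.
Lemma lie0r f : lie f 0 = 0. Proof. by rewrite lieC lie0l oppr0. Qed.
Lemma liexx f : lie f f = 0. Proof. exact: subrr. Qed.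

Lemma jacobi f g h : lie f (lie g h) = lie (lie f g) h + lie g (lie f h).
Proof.
rewrite /lie !mulrBl !mulrBr !mulrA !opprB.
set a := f * g * h; set b := f * h * g; set c := g * h * f.
set d := h * g * f; set e := g * f * h; set k := h * f * g.
by rewrite [RHS]addrACA !subrKA addrACA [RHS]addrACA [- b - c]addrC.
Qed.

End Orders.

Lemma lie_poly_nil (A : eqType) (p : ncseries A) : lie_poly p -> p [::] = 0.
Proof.
elim=> // [x y _ px _ py|c x _ px|x y _ px _ py].
- by rewrite ncDE px py addr0.
- by rewrite ncZE px mulr0.
- exact: lie_nil.
Qed.

(** * Substitution *)

Lemma sum_tuple0 (A : finType) (V : nmodType) (F : seq A -> V) :
  \sum_(w : 0.-tuple A) F w = F [::].
Proof.
rewrite (eq_bigr (fun=> F [::])) => [|w _]; last by rewrite tuple0.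
by rewrite sumr_const card_tuple expn0 mulr1n.
Qed.

Lemma sum_tupleS (A : finType) (V : nmodType) n (F : seq A -> V) :
  \sum_(w : n.+1.-tuple A) F w = \sum_a \sum_(w : n.-tuple A) F (a :: w).
Proof.
rewrite pair_big /=.
rewrite (reindex (fun p : A * n.-tuple A => cons_tuple p.1 p.2)) //=.
exists (fun w => (thead w, behead_tuple w)) => [[a w]|w] _ /=.
  by rewrite theadE; congr (_, _); apply: val_inj.
by apply: val_inj; rewrite /= [in RHS](tuple_eta w).
Qed.

Definition lderiv A (a : A) (f : ncseries A) : ncseries A := fun w => f (a :: w).

Section LeftDerivative.
Variable A : finType.
Implicit Types (f g : ncseries A) (a b : A).

Lemma lderivM a f g : lderiv a (f * g) = f [::] *: lderiv a g + lderiv a f * g.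
Proof. by apply: funext => w; exact: ncmul_cons. Qed.

Lemma lderiv1 a : lderiv a 1 = 0.
Proof. by []. Qed.

Lemma lderiv_letter a b : lderiv a (letter b) = ((a == b)%:R : rat) *: 1.
Proof.
apply: funext => w; rewrite /lderiv /letter ncE eqseq_cons.
by case: eqP; rewrite ?mul1r ?mul0r //; case: w.
Qed.

Lemma letterM a f b w : (letter a * f) (b :: w) = (b == a)%:R * f w.
Proof.
have := congr1 (fun g : ncseries A => g w) (lderivM b (letter a) f).
rewrite lderiv_letter ncDE ncZE mul0r add0r -scalerAl mul1r ncZE => <-.
by [].
Qed.

Lemma series_eta f : f = f [::] *: 1 + \sum_a letter a * lderiv a f.
Proof.
apply: funext => -[|b w]; rewrite ncDE ncsumE !ncE.
  by rewrite mulr1 big1 ?addr0 // => a _; rewrite ncM_nil mul0r.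
rewrite mulr0 add0r (bigD1 b) //= letterM eqxx mul1r big1 ?addr0 // => a.
by rewrite eq_sym letterM => /negPf->; rewrite mul0r.
Qed.

End LeftDerivative.

Section Substitution.
Variables (A : finType) (B : Type) (s : A -> ncseries B).
Implicit Types (f g : ncseries A) (c : rat).

Lemma ncsubstD f g : ncsubst s (f + g) = ncsubst s f + ncsubst s g.
Proof.
apply: funext => v; rewrite ncDE -big_split; apply: eq_bigr => n _ /=.
by rewrite -big_split; apply: eq_bigr => w _; rewrite ncDE mulrDl.
Qed.

Lemma ncsubstZ c f : ncsubst s (c *: f) = c *: ncsubst s f.
Proof.
apply: funext => v; rewrite ncZE mulr_sumr; apply: eq_bigr => n _.
by rewrite mulr_sumr; apply: eq_bigr => w _; rewrite ncZE mulrA.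
Qed.

Lemma ncsubst0 : ncsubst s 0 = 0.
Proof. by rewrite -(scale0r 0) ncsubstZ scale0r. Qed.

Lemma ncsubstN f : ncsubst s (- f) = - ncsubst s f.
Proof. by rewrite -scaleN1r ncsubstZ scaleN1r. Qed.

Lemma ncsubstB f g : ncsubst s (f - g) = ncsubst s f - ncsubst s g.
Proof. by rewrite ncsubstD ncsubstN. Qed.

Lemma ncsubst_sum I (r : seq I) (P : pred I) (F : I -> ncseries A) :
  ncsubst s (\sum_(i <- r | P i) F i) = \sum_(i <- r | P i) ncsubst s (F i).
Proof. exact: (big_morph _ ncsubstD ncsubst0). Qed.

Lemma ncsubst_order n f : order_ge n f -> order_ge n (ncsubst s f).
Proof.
move=> fn v ltv; rewrite [LHS]big1 // => k _; rewrite big1 // => w _.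
by rewrite fn ?mul0r // size_tuple; apply: leq_trans ltv.
Qed.

Hypothesis s_nil : forall a, s a [::] = 0.

Lemma order_ge_prod (w : seq A) : order_ge (size w) (\prod_(a <- w) s a).
Proof.
elim: w => [|a w IH] //=; rewrite big_cons -add1n.
by apply: order_geM => //; exact: order_ge1.
Qed.

Lemma ncsubst_trunc N f :
  order_ge N (ncsubst s f -
    \sum_(n < N) \sum_(w : n.-tuple A) f w *: \prod_(a <- w) s a).
Proof.
move=> v ltv; rewrite ncBE ncsumE; apply/eqP; rewrite subr_eq0; apply/eqP.
rewrite /ncsubst.
have -> : \sum_(n < N) (\sum_(w : n.-tuple A) f w *: \prod_(a <- w) s a) v =
    \sum_(n < N) \sum_(w : n.-tuple A) f w * (\prod_(a <- w) s a) v.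
  by apply: eq_bigr => n _; rewrite ncsumE; apply: eq_bigr.
rewrite -!(big_mkord xpredT (fun n => \sum_(w : n.-tuple A)
  f w * (\prod_(a <- w) s a) v)).
rewrite [RHS](big_cat_nat _ ltv) //= [X in _ = _ + X]big_nat_cond.
rewrite [X in _ = _ + X]big1 ?addr0 // => n /andP[/andP[ltvn _] _].
by rewrite big1 // => w _; rewrite order_ge_prod ?mulr0 // size_tuple.
Qed.

(** Peeling off the first letter of every word turns the defining sum into a
    recursion on left derivatives. *)
Lemma ncsubst_eta f :
  ncsubst s f = f [::] *: 1 + \sum_a s a * ncsubst s (lderiv a f).
Proof.
apply: order_ge_eq => n; pose T n g : ncseries B :=
  \sum_(k < n) \sum_(w : k.-tuple A) g w *: \prod_(a <- w) s a.
apply: (order_ge_trans (g := T n.+1 f)).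
  by apply: (order_geW (leqnSn n)); exact: ncsubst_trunc.
have -> : T n.+1 f = f [::] *: 1 + \sum_a s a * T n (lderiv a f).
  rewrite /T big_ord_recl (sum_tuple0 (fun w => f w *: \prod_(a <- w) s a)).
  rewrite big_nil; congr (_ + _).
  under [RHS]eq_bigr do rewrite mulr_sumr; rewrite exchange_big /=.
  apply: eq_bigr => k _.
  rewrite (sum_tupleS _ (fun w => f w *: \prod_(a <- w) s a)).
  apply: eq_bigr => a _; rewrite mulr_sumr; apply: eq_bigr => w _.
  by rewrite big_cons -scalerAr.
rewrite opprD addrACA subrr add0r -sumrB; apply: order_ge_sum => a _.
rewrite -mulrBr; apply: order_geMl; apply: order_ge_sym; exact: ncsubst_trunc.
Qed.

(** As the [s a] have no constant term, the recursion [ncsubst_eta] is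
    contracting for the degree topology, so it has only one solution. The
    multiplicativity and the composition of substitutions come from this
    uniqueness; the factor h allows one factor of a product to be fixed. *)
Lemma ncsubst_unique (G : ncseries A -> ncseries B) (h : ncseries B) :
  (forall f, G f = f [::] *: h + \sum_a s a * G (lderiv a f)) ->
  forall f, G f = ncsubst s f * h.
Proof.
move=> Geta f; apply: order_ge_eq => n.
elim: n f => [|n IH] f; first exact: order_ge0.
rewrite Geta ncsubst_eta mulrDl -scalerAl mul1r opprD addrACA subrr add0r.
rewrite mulr_suml -sumrB; apply: order_ge_sum => a _.
rewrite -mulrA -mulrBr -add1n; apply: order_geM (IH _).
by apply: order_ge1; exact: s_nil.
Qed.

Lemma ncsubst1 : ncsubst s 1 = 1.
Proof.
rewrite ncsubst_eta big1 => [|a _]; last by rewrite lderiv1 ncsubst0 mulr0.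
by rewrite addr0 nc1E scale1r.
Qed.

Lemma ncsubst_letter a : ncsubst s (letter a) = s a.
Proof.
rewrite ncsubst_eta scale0r add0r (bigD1 a) //= big1 => [|b /negPf ba].
  by rewrite lderiv_letter eqxx scale1r ncsubst1 mulr1 addr0.
by rewrite lderiv_letter ba scale0r ncsubst0 mulr0.
Qed.

Lemma ncsubstM f g : ncsubst s (f * g) = ncsubst s f * ncsubst s g.
Proof.
apply: (ncsubst_unique (G := fun f => ncsubst s (f * g))) => {}f.
rewrite [LHS]ncsubst_eta ncM_nil -scalerA [ncsubst s g]ncsubst_eta scalerDr.
rewrite -addrA; congr (_ + _); rewrite scaler_sumr -big_split.
apply: eq_bigr => a _ /=; rewrite lderivM ncsubstD mulrDr ncsubstZ -scalerAr.
by [].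
Qed.

Lemma ncsubstX n f : ncsubst s (f ^+ n) = ncsubst s f ^+ n.
Proof.
by elim: n => [|n IH]; rewrite ?expr0 ?ncsubst1 // !exprS ncsubstM IH.
Qed.

Lemma ncsubst_lie f g :
  ncsubst s (lie f g) = lie (ncsubst s f) (ncsubst s g).
Proof. by rewrite ncsubstB !ncsubstM. Qed.

Lemma ncsubst_nil f : ncsubst s f [::] = f [::].
Proof.
rewrite ncsubst_eta ncDE ncsumE big1 ?addr0 ?ncZE ?mulr1 // => a _.
by rewrite ncM_nil s_nil mul0r.
Qed.

End Substitution.

Lemma ncsubst_id (A : finType) (f : ncseries A) : ncsubst (@letter A) f = f.
Proof.
rewrite -[LHS]mulr1 -(@ncsubst_unique _ _ (@letter A) _ id) // => g.
exact: series_eta.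
Qed.

Lemma ncsubst_comp (A B : finType) (C : Type) (s : B -> ncseries C)
    (r : A -> ncseries B) (f : ncseries A) :
  (forall a, r a [::] = 0) -> (forall b, s b [::] = 0) ->
  ncsubst s (ncsubst r f) = ncsubst (fun a => ncsubst s (r a)) f.
Proof.
move=> r_nil s_nil.
have sr_nil a : ncsubst s (r a) [::] = 0 by rewrite ncsubst_nil.
rewrite -[RHS]mulr1 -(@ncsubst_unique _ _ _ sr_nil (ncsubst s \o ncsubst r)) //= => g.
rewrite (ncsubst_eta r_nil) ncsubstD ncsubstZ ncsubst1 // ncsubst_sum.
by congr (_ + _); apply: eq_bigr => a _; rewrite ncsubstM.
Qed.

(** * Exponentials *)

Lemma ncexp_trunc (A : Type) N (x : ncseries A) : x [::] = 0 ->
  order_ge N (ncexp x - \sum_(n < N) (n`!%:R : rat)^-1 *: x ^+ n).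
Proof.
move=> x0 w ltw; rewrite ncBE ncsumE; apply/eqP; rewrite subr_eq0; apply/eqP.
rewrite /ncexp; under [RHS]eq_bigr do rewrite ncZE.
rewrite -!(big_mkord xpredT (fun n => (n`!%:R)^-1 * (x ^+ n) w)).
rewrite [RHS](big_cat_nat _ ltw) //= [X in _ = _ + X]big_nat_cond.
rewrite [X in _ = _ + X]big1 ?addr0 // => n /andP[/andP[ltwn _] _].
by rewrite order_geX ?mulr0.
Qed.
Arguments ncexp_trunc [A] N [x].

Section Exponential.
Variable A : Type.
Implicit Types x y : ncseries A.

Lemma ncexp_nil x : ncexp x [::] = 1.
Proof. by rewrite /ncexp big_ord1 expr0 nc1E invr1 mulr1. Qed.

Lemma ncexp_letter x a : ncexp x [:: a] = x [:: a].
Proof.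
by rewrite /ncexp !big_ord_recl big_ord0 /= expr0 nc1E invr1 mulr0 add0r mul1r addr0.
Qed.

Lemma ncexp0 : ncexp (0 : ncseries A) = 1.
Proof.
apply: funext => w; rewrite /ncexp big_ord_recl big1 ?addr0 /= => [|i _].
  by rewrite expr0 invr1 mul1r.
by rewrite exprS mul0r nc0E mulr0.
Qed.

Lemma ncexp_order n x y : x [::] = 0 -> y [::] = 0 ->
  order_ge n (x - y) -> order_ge n (ncexp x - ncexp y).
Proof.
move=> x0 y0 xy; apply: (order_ge_trans (ncexp_trunc n x0)).
apply: (order_ge_trans _ (order_ge_sym (ncexp_trunc n y0))).
rewrite -sumrB; apply: order_ge_sum => k _; rewrite -scalerBr.
by apply: order_geZ; exact: order_ge_exp.
Qed.

End Exponential.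

Lemma ncsubst_exp (A : finType) (B : Type) (s : A -> ncseries B)
    (x : ncseries A) :
  (forall a, s a [::] = 0) -> x [::] = 0 ->
  ncsubst s (ncexp x) = ncexp (ncsubst s x).
Proof.
move=> s0 x0; apply: order_ge_eq => n.
have sx0 : ncsubst s x [::] = 0 by rewrite ncsubst_nil.
apply: (order_ge_trans _ (order_ge_sym (ncexp_trunc n sx0))).
have -> : \sum_(k < n) (k`!%:R : rat)^-1 *: ncsubst s x ^+ k =
    ncsubst s (\sum_(k < n) (k`!%:R : rat)^-1 *: x ^+ k).
  by rewrite ncsubst_sum; apply: eq_bigr => k _; rewrite ncsubstZ ncsubstX.
by rewrite -ncsubstB; apply: ncsubst_order; exact: ncexp_trunc.
Qed.

(** * Closed ideals and closed subalgebras *)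

(** Two-sided ideals, closed for the degree topology. Congruences modulo such an
    ideal are compatible with products and exponentials, which replaces
    computations in a completed quotient algebra. *)
Record closed_ideal A (I : ncseries A -> Prop) : Prop := ClosedIdeal {
  ideal0 : I 0;
  idealD : forall x y, I x -> I y -> I (x + y);
  idealM : forall a x b, I x -> I (a * x * b);
  ideal_lim : forall x,
    (forall n, exists2 y, I y & order_ge n (x - y)) -> I x }.

(** The examples of interest are centralizers modulo a closed ideal: they contain
    every series obtained from their elements by substitution or
    exponentiation. *)
Record closed_subalgebra A (P : ncseries A -> Prop) : Prop := ClosedSubalgebra {
  subalg1 : P 1;
  subalgD : forall x y, P x -> P y -> P (x + y);
  subalgZ : forall c x, P x -> P (c *: x);
  subalgM : forall x y, P x -> P y -> P (x * y);
  subalg_lim : forall x,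
    (forall n, exists2 y, P y & order_ge n (x - y)) -> P x }.

Section Ideals.
Variables (A : Type) (I : ncseries A -> Prop).
Hypothesis I_closed : closed_ideal I.
Implicit Types x y z : ncseries A.

Lemma idealMl a x : I x -> I (a * x).
Proof. by move=> Ix; rewrite -[_ * _]mulr1; exact: (idealM I_closed). Qed.

Lemma idealMr a x : I x -> I (x * a).
Proof. by move=> Ix; rewrite -[x]mul1r; exact: (idealM I_closed). Qed.

Lemma idealZ c x : I x -> I (c *: x).
Proof. by move=> Ix; rewrite -[x]mul1r scalerAl; exact: idealMl. Qed.

Lemma idealN x : I x -> I (- x).
Proof. by rewrite -scaleN1r; exact: idealZ. Qed.

Lemma ideal_sum J (r : seq J) (P : pred J) F :
  (forall i, P i -> I (F i)) -> I (\sum_(i <- r | P i) F i).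
Proof.
move=> IF; elim/big_ind: _ => //; first exact: (ideal0 I_closed).
exact: (idealD I_closed).
Qed.

Lemma ideal_trans y x z : I (x - y) -> I (y - z) -> I (x - z).
Proof. by move=> xy yz; rewrite -(subrKA y); exact: (idealD I_closed). Qed.

Lemma ideal_sym x y : I (x - y) -> I (y - x).
Proof. by move=> xy; rewrite -opprB; exact: idealN. Qed.

Lemma ideal_mul x x' y y' : I (x - x') -> I (y - y') -> I (x * y - x' * y').
Proof.
move=> xx yy; rewrite -(subrKA (x' * y)) -mulrBl -mulrBr.
by apply: (idealD I_closed); [exact: idealMr | exact: idealMl].
Qed.

Lemma ideal_exp x y k : I (x - y) -> I (x ^+ k - y ^+ k).
Proof.
move=> xy; elim: k => [|k IH]; first by rewrite subrr; exact: (ideal0 I_closed).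
by rewrite !exprS; exact: ideal_mul.
Qed.

Lemma ideal_ncexp x y : x [::] = 0 -> y [::] = 0 ->
  I (x - y) -> I (ncexp x - ncexp y).
Proof.
move=> x0 y0 xy; apply: (ideal_lim I_closed) => n.
exists (\sum_(k < n) (k`!%:R : rat)^-1 *: x ^+ k -
        \sum_(k < n) (k`!%:R : rat)^-1 *: y ^+ k).
  rewrite -sumrB; apply: ideal_sum => k _; rewrite -scalerBr.
  by apply: idealZ; exact: ideal_exp.
rewrite opprD addrACA -opprD.
by apply: order_geB; exact: ncexp_trunc.
Qed.

Lemma centralizer_closed z : closed_subalgebra (fun x => I (lie z x)).
Proof.
split=> [|x y Ix Iy|c x Ix|x y Ix Iy|x limx].
- by rewrite /lie mulr1 mul1r subrr; exact: (ideal0 I_closed).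
- by rewrite lieDr; exact: (idealD I_closed).
- by rewrite lieZr; exact: idealZ.
- rewrite /lie -(subrKA (x * z * y)) mulrA -mulrBl -!mulrA -mulrBr.
  by apply: (idealD I_closed); [exact: idealMr | exact: idealMl].
- apply: (ideal_lim I_closed) => n; have [y Iy xy] := limx n.
  exists (lie z y) => //; rewrite -lieBr.
  by apply: order_geB; [exact: order_geMl | exact: order_geMr].
Qed.

End Ideals.

Section Subalgebras.
Variables (B : Type) (P : ncseries B -> Prop).
Hypothesis P_closed : closed_subalgebra P.

Lemma subalg0 : P 0.
Proof. by rewrite -(scale0r 1); apply: (subalgZ P_closed); exact: subalg1. Qed.

Lemma subalg_sum J (r : seq J) (Q : pred J) F :
  (forall i, Q i -> P (F i)) -> P (\sum_(i <- r | Q i) F i).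
Proof.
move=> PF; elim/big_ind: _ => //; first exact: subalg0.
exact: (subalgD P_closed).
Qed.

Lemma subalg_ncsubst (A : finType) (s : A -> ncseries B) f :
  (forall a, s a [::] = 0) -> (forall a, P (s a)) -> P (ncsubst s f).
Proof.
move=> s0 Ps; apply: (subalg_lim P_closed) => n.
exists (\sum_(k < n) \sum_(w : k.-tuple A) f w *: \prod_(a <- w) s a).
  apply: subalg_sum => k _; apply: subalg_sum => w _; apply: (subalgZ P_closed).
  elim/big_ind: _ => //; first exact: (subalg1 P_closed).
  exact: (subalgM P_closed).
exact: ncsubst_trunc.
Qed.

Lemma subalg_ncexp (x : ncseries B) : x [::] = 0 -> P x -> P (ncexp x).
Proof.
move=> x0 Px; apply: (subalg_lim P_closed) => n.
exists (\sum_(k < n) (k`!%:R : rat)^-1 *: x ^+ k).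
  apply: subalg_sum => k _; apply: (subalgZ P_closed).
  elim: (nat_of_ord k) => [|m IH]; first exact: (subalg1 P_closed).
  by rewrite exprS; exact: (subalgM P_closed).
exact: ncexp_trunc.
Qed.

End Subalgebras.

Lemma closed_ideal_zero A : closed_ideal (fun x : ncseries A => x = 0).
Proof.
split=> // [x y -> ->|a x b ->|x limx]; rewrite ?addr0 ?mulr0 ?mul0r //.
apply: order_ge_eq0 => n; have [y y0] := limx n.
by rewrite y0 subr0.
Qed.

Lemma closed_ideal_ker (A : finType) B (s : A -> ncseries B) :
  (forall a, s a [::] = 0) -> closed_ideal (fun x => ncsubst s x = 0).
Proof.
move=> s0; split=> [|x y sx sy|a x b sx|x limx].
- exact: ncsubst0.
- by rewrite ncsubstD sx sy addr0.
- by rewrite !ncsubstM // sx mulr0 mul0r.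
- apply: order_ge_eq0 => n; have [y sy xy] := limx n.
  by rewrite -[ncsubst s x]subr0 -sy -ncsubstB; exact: ncsubst_order.
Qed.

(** ** Exponential of a sum of commuting series *)

(** Pascal's recursion for divided powers: if [B k l] is the product of the k-th
    divided power of x and the l-th one of y, for commuting x and y, then
    [(x + y) * B k l] is [B k.+1 l *+ k.+1 + B k l.+1 *+ l.+1]. *)
Lemma pascal_sum (V : nmodType) (B : nat -> nat -> V) n :
  \sum_(k < n.+1) (B k.+1 (n - k)%N *+ k.+1 + B k (n - k).+1 *+ (n - k).+1) =
  (\sum_(k < n.+2) B k (n.+1 - k)%N) *+ n.+1.
Proof.
have -> : (\sum_(k < n.+2) B k (n.+1 - k)%N) *+ n.+1 =
    \sum_(k < n.+2) B k (n.+1 - k)%N *+ k +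
    \sum_(k < n.+2) B k (n.+1 - k)%N *+ (n.+1 - k).
  rewrite -sumrMnl -big_split; apply: eq_bigr => k _ /=.
  by rewrite -mulrnDr subnKC // -ltnS.
rewrite big_split /= [X in _ = X + _]big_ord_recl mulr0n add0r.
rewrite [X in _ = _ + X]big_ord_recr /= subnn mulr0n addr0.
congr (_ + _); apply: eq_bigr => k _ //.
by rewrite subSn // -ltnS.
Qed.

Lemma sum_triangle (V : nmodType) (B : nat -> nat -> V) N :
  \sum_(n < N) \sum_(k < n.+1) B k (n - k)%N =
  \sum_(k < N) \sum_(l < N - k) B k l.
Proof.
elim: N => [|N IH]; first by rewrite !big_ord0.
have -> : \sum_(k < N.+1) \sum_(l < N.+1 - k) B k l =
    \sum_(k < N.+1) (\sum_(l < N - k) B k l + B k (N - k)%N).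
  by apply: eq_bigr => k _; rewrite subSn -1?ltnS // big_ord_recr.
rewrite big_ord_recr IH big_split /=; congr (_ + _).
by rewrite [RHS]big_ord_recr /= subnn big_ord0 addr0.
Qed.

Definition divided_power A (x : ncseries A) n : ncseries A :=
  (n`!%:R : rat)^-1 *: x ^+ n.

Lemma divided_powerS A (x : ncseries A) n :
  x * divided_power x n = divided_power x n.+1 *+ n.+1.
Proof.
rewrite /divided_power -scalerAr -exprS scalerMnl; congr (_ *: _).
rewrite factS natrM invfM -[RHS]mulr_natr [RHS]mulrC mulrA divff ?mul1r //.
by rewrite Num.Theory.pnatr_eq0.
Qed.

Lemma ncexp_divided (A : Type) N (x : ncseries A) : x [::] = 0 ->
  order_ge N (ncexp x - \sum_(n < N) divided_power x n).
Proof. exact: ncexp_trunc. Qed.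
Arguments ncexp_divided [A] N [x].

Lemma order_ge_divided A (x : ncseries A) n :
  x [::] = 0 -> order_ge n (divided_power x n).
Proof. by move=> x0; apply: order_geZ; exact: order_geX. Qed.

(** The products whose total degree is at least N do not count below degree N,
    so a square of indices may replace a triangle. *)
Lemma square_triangle A N (B : nat -> nat -> ncseries A) :
  (forall k l, order_ge (k + l) (B k l)) ->
  order_ge N (\sum_(k < N) \sum_(l < N) B k l -
              \sum_(n < N) \sum_(k < n.+1) B k (n - k)%N).
Proof.
move=> ordB; rewrite sum_triangle -sumrB; apply: order_ge_sum => k _.
rewrite -!(big_mkord xpredT (B k)) (big_cat_nat _ (leq_subr k N)) //= addrAC subrr add0r.
rewrite big_nat_cond; apply: order_ge_sum => l; rewrite andbT => /andP[lel _].
by apply: order_geW (ordB k l); rewrite -leq_subLR.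
Qed.

Section ExpAdd.
Variables (A : Type) (I : ncseries A -> Prop).
Hypothesis I_closed : closed_ideal I.
Variables x y : ncseries A.
Hypotheses (x0 : x [::] = 0) (y0 : y [::] = 0) (Ixy : I (lie x y)).

Lemma divided_powerD n : I (divided_power (x + y) n -
  \sum_(k < n.+1) divided_power x k * divided_power y (n - k)).
Proof.
pose B k l := divided_power x k * divided_power y l.
elim: n => [|n IH].
  rewrite big_ord1 /divided_power !expr0 invr1 !scale1r mulr1 subrr.
  exact: (ideal0 I_closed).
have n1_unit : n.+1%:R != 0 :> rat by rewrite Num.Theory.pnatr_eq0.
rewrite -[X in I X]scale1r -(mulVf n1_unit) -scalerA.
apply: (idealZ I_closed); rewrite scaler_nat mulrnBl -divided_powerS.
rewrite -(pascal_sum B).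
have := idealMl I_closed (x + y) IH; rewrite mulrBr => IHn.
apply: (ideal_trans I_closed IHn).
rewrite mulr_sumr -sumrB; apply: (ideal_sum I_closed) => k _.
have -> : B k.+1 (n - k)%N *+ k.+1 + B k (n - k).+1 *+ (n - k).+1 =
    x * B k (n - k)%N + divided_power x k * (y * divided_power y (n - k)).
  by rewrite /B mulrA !divided_powerS mulrnAl mulrnAr.
rewrite mulrDl opprD addrACA subrr add0r !mulrA -mulrBl.
apply: (idealMr I_closed); rewrite -/(lie y _).
apply: (subalgZ (centralizer_closed I_closed y)).
elim: (nat_of_ord k) => [|m IHm]; first exact: (subalg1 (centralizer_closed I_closed y)).
rewrite exprS; apply: (subalgM (centralizer_closed I_closed y)) => //.
by rewrite lieC; exact: (idealN I_closed).
Qed.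

(** The binomial formula holds modulo I; below degree n only finitely many
    divided powers count. *)
Lemma ncexpD : I (ncexp (x + y) - ncexp x * ncexp y).
Proof.
have xy0 : (x + y) [::] = 0 by rewrite ncDE x0 y0 addr0.
pose B k l := divided_power x k * divided_power y l.
apply: (ideal_lim I_closed) => n.
exists (\sum_(m < n) (divided_power (x + y) m - \sum_(k < m.+1) B k (m - k)%N)).
  by apply: (ideal_sum I_closed) => m _; exact: divided_powerD.
rewrite sumrB opprD addrACA -opprD; apply: order_geB.
  exact: ncexp_divided.
apply: (order_ge_trans (order_ge_mul (ncexp_divided n x0) (ncexp_divided n y0))).
rewrite mulr_suml; under eq_bigr do rewrite mulr_sumr.
apply: square_triangle => k l.
by apply: order_geM; exact: order_ge_divided.
Qed.

End ExpAdd.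

(** * Coproduct *)

Section Coproduct.
Variable A : finType.
Implicit Types (f g p : ncseries A) (u v w : seq A) (F G : seq A -> seq A -> rat).

Lemma coproductD f g u v :
  coproduct (f + g) u v = coproduct f u v + coproduct g u v.
Proof. by rewrite -big_split; apply: eq_bigr => w _; rewrite ncDE mulrDl. Qed.

Lemma coproductZ c f u v : coproduct (c *: f) u v = c * coproduct f u v.
Proof. by rewrite mulr_sumr; apply: eq_bigr => w _; rewrite ncZE mulrA. Qed.

Lemma coproduct0 u v : coproduct (0 : ncseries A) u v = 0.
Proof. by rewrite -(scale0r 0) coproductZ mul0r. Qed.

Lemma coproductB f g u v :
  coproduct (f - g) u v = coproduct f u v - coproduct g u v.
Proof. by rewrite -scaleN1r coproductD coproductZ mulN1r. Qed.

Lemma coproduct_sum I (r : seq I) (P : pred I) (H : I -> ncseries A) u v :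
  coproduct (\sum_(i <- r | P i) H i) u v =
  \sum_(i <- r | P i) coproduct (H i) u v.
Proof.
apply: (big_morph (fun f => coproduct f u v)); last exact: coproduct0.
by move=> f g; exact: coproductD.
Qed.

Lemma coproduct_local f g u v :
  (forall w, size w = (size u + size v)%N -> f w = g w) ->
  coproduct f u v = coproduct g u v.
Proof. by move=> fg; apply: eq_bigr => w _; rewrite fg ?size_tuple. Qed.

Lemma count_unshuffles u v z w :
  count_mem (u, v) (unshuffles (z :: w)) =
  ((if u is x :: u' then (x == z) * count_mem (u', v) (unshuffles w) else 0) +
   (if v is y :: v' then (y == z) * count_mem (u, v') (unshuffles w) else 0))%N.
Proof.
rewrite /= count_cat !count_map; congr addn.
  case: u => [|x u]; first by rewrite -(count_pred0 (unshuffles w)); apply: eq_count.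
  rewrite eq_sym; case: eqVneq => [->|/negPf zx]; rewrite ?mul1n ?mul0n.
    by apply: eq_count => -[u' v'] /=; rewrite !xpair_eqE eqseq_cons eqxx.
  rewrite -(count_pred0 (unshuffles w)); apply: eq_count => -[u' v'] /=.
  by rewrite !xpair_eqE eqseq_cons zx.
case: v => [|y v].
  rewrite -(count_pred0 (unshuffles w)); apply: eq_count => -[u' v'] /=.
  by rewrite xpair_eqE andbF.
rewrite eq_sym; case: eqVneq => [->|/negPf zy]; rewrite ?mul1n ?mul0n.
  by apply: eq_count => -[u' v'] /=; rewrite !xpair_eqE eqseq_cons eqxx.
rewrite -(count_pred0 (unshuffles w)); apply: eq_count => -[u' v'] /=.
by rewrite !xpair_eqE eqseq_cons zy andbF.
Qed.

Lemma sum_lderiv n x f (N : seq A -> nat) :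
  \sum_(w : n.+1.-tuple A) f w * ((x == head x w) * N (behead w))%:R =
  \sum_(w : n.-tuple A) f (x :: w) * (N w)%:R.
Proof.
rewrite (sum_tupleS _ (fun w => f w * ((x == head x w) * N (behead w))%:R)).
rewrite (bigD1 x) //= eqxx [X in _ + X]big1 ?addr0 => [|a /negPf ax].
  by apply: eq_bigr => w _; rewrite mul1n.
by rewrite big1 // => w _; rewrite eq_sym ax mulr0.
Qed.

(** The first letter of a word is primitive, so it ends up at the head of one of
    the two tensor factors. *)
Lemma coproduct_rec f u v :
  coproduct f u v =
    (nilp u && nilp v)%:R * f [::] +
    (if u is x :: u' then coproduct (lderiv x f) u' v else 0) +
    (if v is y :: v' then coproduct (lderiv y f) u v' else 0).
Proof.
have [n szn] : exists n, n = (size u + size v)%N by exists (size u + size v)%N.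
rewrite /coproduct -szn; case: n szn => [|n] szn.
  case: u v szn => [|x u] [|y v] //= _.
  by rewrite (sum_tuple0 (fun w => f w * (count_mem ([::], [::]) (unshuffles w))%:R))
    /= mulr1 !addr0 mul1r.
rewrite (_ : nilp u && nilp v = false); last by case: u v szn => [|x u] [|y v].
rewrite mul0r add0r; transitivity (
  \sum_(w : n.+1.-tuple A) (f w *
    (if u is x :: u' then (x == head x w) *
       count_mem (u', v) (unshuffles (behead w)) else 0)%N%:R +
  f w *
    (if v is y :: v' then (y == head y w) *
       count_mem (u, v') (unshuffles (behead w)) else 0)%N%:R)).
  apply: eq_bigr => w _; rewrite -mulrDr -natrD; congr (f w * _%:R).
  rewrite (tuple_eta w) count_unshuffles /=.
  by case: u {szn} => [|x u]; case: v => [|y v].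
rewrite big_split /=; congr (_ + _).
  case: u szn => [|x u] szn; first by rewrite big1 // => w _; rewrite mulr0.
  rewrite (sum_lderiv _ x f (fun w => count_mem (u, v) (unshuffles w))).
  by case: szn => <-.
case: v szn => [|y v] szn; first by rewrite big1 // => w _; rewrite mulr0.
rewrite (sum_lderiv _ y f (fun w => count_mem (u, v) (unshuffles w))).
by move: szn; rewrite addnS => -[<-].
Qed.

Lemma coproduct_nilr f u : coproduct f u [::] = f u.
Proof.
elim: u f => [|x u IH] f; rewrite coproduct_rec /=.
  by rewrite mul1r !addr0.
by rewrite mul0r add0r addr0 IH.
Qed.

(** A function of two words is an element of the completed tensor square of the
    algebra of series; this is the product of that algebra. *)
Definition tensor_mul F G u v : rat :=
  \sum_(i < (size u).+1) \sum_(j < (size v).+1)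
    F (take i u) (take j v) * G (drop i u) (drop j v).

Definition tensor f g u v : rat := f u * g v.

Lemma tensor_mulDl F F' G u v :
  tensor_mul (fun u v => F u v + F' u v) G u v =
  tensor_mul F G u v + tensor_mul F' G u v.
Proof.
rewrite -big_split; apply: eq_bigr => i _; rewrite -big_split.
by apply: eq_bigr => j _; rewrite mulrDl.
Qed.

Lemma tensor_mulDr F G G' u v :
  tensor_mul F (fun u v => G u v + G' u v) u v =
  tensor_mul F G u v + tensor_mul F G' u v.
Proof.
rewrite -big_split; apply: eq_bigr => i _; rewrite -big_split.
by apply: eq_bigr => j _; rewrite mulrDr.
Qed.

Lemma tensor_mul_sumr I (r : seq I) F (G : I -> seq A -> seq A -> rat) u v :
  tensor_mul F (fun u v => \sum_(i <- r) G i u v) u v =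
  \sum_(i <- r) tensor_mul F (G i) u v.
Proof.
rewrite exchange_big; apply: eq_bigr => i _ /=; rewrite exchange_big.
by apply: eq_bigr => j _ /=; rewrite mulr_sumr.
Qed.

Lemma tensor_mulE f g f' g' u v :
  tensor_mul (tensor f g) (tensor f' g') u v = tensor (f * f') (g * g') u v.
Proof.
rewrite /tensor !ncME big_distrlr; apply: eq_bigr => i _; apply: eq_bigr => j _.
by rewrite mulrACA.
Qed.

Lemma tensor_mul_const c G u v :
  tensor_mul (fun u v => (nilp u && nilp v)%:R * c) G u v = c * G u v.
Proof.
rewrite /tensor_mul big_ord_recl big_ord_recl !take0 !drop0 mul1r.
rewrite big1 ?addr0 => [|j _]; last first.
  by case: v j => [|y v] j; [case: j | rewrite /= !mul0r].
rewrite big1 ?addr0 // => i _; rewrite big1 // => j _.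
by case: u i => [|x u] i; [case: i | rewrite /= !mul0r].
Qed.

Lemma tensor_mul_consl (H : A -> seq A -> seq A -> rat) G u v :
  tensor_mul (fun u v => if u is x :: u' then H x u' v else 0) G u v =
  if u is x :: u' then tensor_mul (H x) G u' v else 0.
Proof.
case: u => [|x u].
  by rewrite /tensor_mul big_ord1 big1 // => j _; rewrite mul0r.
rewrite {1}/tensor_mul big_ord_recl big1 ?add0r // => j _.
by rewrite take0 mul0r.
Qed.

Lemma tensor_mul_consr (H : A -> seq A -> seq A -> rat) G u v :
  tensor_mul (fun u v => if v is y :: v' then H y u v' else 0) G u v =
  if v is y :: v' then tensor_mul (H y) G u v' else 0.
Proof.
case: v => [|y v].
  by rewrite /tensor_mul big1 // => i _; rewrite big_ord1 mul0r.
apply: eq_bigr => i _; rewrite big_ord_recl take0 mul0r add0r.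
by [].
Qed.

(** Expanding the first tensor factor by [coproduct_rec] splits its product with
    the second into a constant part and two parts with a shorter word, to which
    induction applies. *)
Lemma coproductM f g u v :
  coproduct (f * g) u v = tensor_mul (coproduct f) (coproduct g) u v.
Proof.
have [n] := ubnP (size u + size v); elim: n f g u v => // n IH f g u v ltn.
have -> : coproduct f = fun u v => (nilp u && nilp v)%:R * f [::] +
    (if u is x :: u' then coproduct (lderiv x f) u' v else 0) +
    (if v is y :: v' then coproduct (lderiv y f) u v' else 0).
  by apply: funext => u'; apply: funext => v'; exact: coproduct_rec.
rewrite !tensor_mulDl tensor_mul_const.
rewrite (tensor_mul_consl (fun x => coproduct (lderiv x f))).
rewrite (tensor_mul_consr (fun y => coproduct (lderiv y f))).
rewrite coproduct_rec [in RHS]coproduct_rec !mulrDr ncM_nil mulrCA.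
rewrite -[RHS]addrA [X in _ = X + _]addrAC -![RHS]addrA -[LHS]addrA.
congr (_ + _); rewrite [RHS]addrCA [RHS]addrA [RHS]addrACA.
congr (_ + _).
  case: u ltn => [|x u] ltn; first by rewrite mulr0 addr0.
  by rewrite lderivM coproductD coproductZ (IH (lderiv x f)).
case: v ltn => [|y v] ltn; first by rewrite mulr0 addr0.
rewrite lderivM coproductD coproductZ (IH (lderiv y f)) //.
by move: ltn; rewrite addnS.
Qed.

(** ** Primitive series *)

Definition primitive p := forall u v,
  coproduct p u v = tensor p 1 u v + tensor 1 p u v.

Lemma primitive_coproduct p : primitive p ->
  coproduct p = fun u v => tensor p 1 u v + tensor 1 p u v.
Proof. by move=> pp; apply: funext => u; apply: funext => v; exact: pp. Qed.

Lemma primitive0 : primitive 0.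
Proof. by move=> u v; rewrite coproduct0 /tensor mul0r mulr0 addr0. Qed.

Lemma primitiveD f g : primitive f -> primitive g -> primitive (f + g).
Proof.
move=> pf pg u v; rewrite coproductD pf pg /tensor !ncDE mulrDl mulrDr.
by rewrite addrACA.
Qed.

Lemma primitiveZ c f : primitive f -> primitive (c *: f).
Proof.
move=> pf u v; rewrite coproductZ pf mulrDr /tensor !ncZE.
by congr (_ + _); [exact: mulrA | exact: mulrCA].
Qed.

Lemma primitive_letter a : primitive (letter a).
Proof.
have cop1 u v : coproduct (1 : ncseries A) u v = (nilp u && nilp v)%:R.
  rewrite coproduct_rec mulr1; case: u v => [|x u] [|y v] /=;
  by rewrite ?lderiv1 ?coproduct0 ?addr0.
move=> u v; rewrite coproduct_rec mulr0 add0r /tensor.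
case: u v => [|x u] [|y v] /=;
  rewrite ?lderiv_letter ?coproductZ ?cop1 /letter ?nc1E /nilp /=
    ?eqseq_cons ?mul0r ?mulr0 ?mul1r ?mulr1 ?addr0 ?add0r //.
- by rewrite size_eq0 -natrM mulnb.
- by rewrite andbT size_eq0 -natrM mulnb.
- by rewrite andbF mulr0.
Qed.

(** In the coproduct of a product of primitive elements, the mixed terms are
    symmetric in the two factors and cancel in a bracket. *)
Lemma primitive_lie f g : primitive f -> primitive g -> primitive (lie f g).
Proof.
have half x y u v : primitive x -> primitive y -> coproduct (x * y) u v =
    tensor (x * y) 1 u v + tensor 1 (x * y) u v +
    (tensor x y u v + tensor y x u v).
  move=> px py; rewrite coproductM (primitive_coproduct px).
  rewrite (primitive_coproduct py) tensor_mulDl !tensor_mulDr !tensor_mulE.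
  rewrite !mulr1 !mul1r [X in _ + X]addrC -!addrA; congr (_ + _).
  by rewrite addrCA.
move=> pf pg u v; rewrite /lie coproductB !half // [tensor g f u v + _]addrC.
rewrite opprD addrACA subrr addr0 opprD addrACA /tensor !ncBE mulrBl.
by rewrite mulrBr.
Qed.

Lemma lie_poly_primitive p : lie_poly p -> primitive p.
Proof.
elim=> [|a|x y _ px _ py|c x _ px|x y _ px _ py].
- exact: primitive0.
- exact: primitive_letter.
- exact: primitiveD.
- exact: primitiveZ.
- exact: primitive_lie.
Qed.

(** ** Group-like series *)

Lemma grouplikeM f g : grouplike f -> grouplike g -> grouplike (f * g).
Proof.
move=> [f1 Df] [g1 Dg]; split=> [|u v]; first by rewrite ncM_nil f1 g1 mulr1.
have -> : coproduct (f * g) u v = tensor (f * g) (f * g) u v.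
  rewrite coproductM -tensor_mulE; congr tensor_mul;
  by apply: funext => u'; apply: funext => v'.
by [].
Qed.

(** The summands of the coproduct of p commute, so its powers obey the binomial
    formula. *)
Lemma coproduct_divided_power p n u v : primitive p ->
  coproduct (divided_power p n) u v =
  \sum_(k < n.+1) tensor (divided_power p k) (divided_power p (n - k)) u v.
Proof.
move=> pp; elim: n u v => [|n IH] u v.
  rewrite big_ord1 /divided_power !expr0 invr1 !scale1r coproduct_rec mulr1.
  rewrite /tensor !nc1E; case: u v => [|x u] [|y v] /=;
  by rewrite ?lderiv1 ?coproduct0 ?addr0 ?mulr0 ?mul0r ?mulr1.
pose B k l := tensor (divided_power p k) (divided_power p l) u v.
apply: (mulfI (x := n.+1%:R)); first by rewrite Num.Theory.pnatr_eq0.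
rewrite -coproductZ scaler_nat -divided_powerS coproductM.
rewrite mulr_natl -(pascal_sum B) (primitive_coproduct pp).
have -> : coproduct (divided_power p n) = fun u v => \sum_(k < n.+1)
    tensor (divided_power p k) (divided_power p (n - k)) u v.
  by apply: funext => u'; apply: funext => v'; exact: IH.
rewrite tensor_mul_sumr; apply: eq_bigr => k _.
rewrite tensor_mulDl !tensor_mulE !mul1r !divided_powerS /B /tensor.
have ncMnE (f : ncseries A) m w : (f *+ m) w = f w *+ m.
  by elim: m => // m IHm; rewrite !mulrS ncDE IHm.
by rewrite !ncMnE mulrnAl mulrnAr.
Qed.

(** Below, k and l range over a triangle; outside it, a divided power of p
    vanishes at u or at v for reasons of degree. *)
Lemma ncexp_grouplike p : primitive p -> p [::] = 0 -> grouplike (ncexp p).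
Proof.
move=> pp p0; split=> [|u v]; first exact: ncexp_nil.
pose P := divided_power p; pose N := (size u + size v).+1.
have expE w : (size w < N)%N -> ncexp p w = \sum_(k < N) P k w.
  move=> ltw; rewrite -(ncsumE _ _ (fun k : 'I_N => P k)); apply/eqP.
  rewrite -subr_eq0; apply/eqP.
  have := @ncexp_divided _ N _ p0 w ltw; rewrite ncBE; apply.
transitivity (coproduct (\sum_(n < N) P n) u v).
  by apply: coproduct_local => w szw; rewrite expE ?ncsumE // szw.
rewrite coproduct_sum.
under eq_bigr do rewrite coproduct_divided_power //.
rewrite (sum_triangle (fun k l => tensor (P k) (P l) u v)).
rewrite !expE ?ltnS ?leq_addl ?leq_addr // big_distrlr.
apply: eq_bigr => k _ /=.
rewrite -!(big_mkord xpredT (fun l => P k u * P l v)).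
rewrite [RHS](big_cat_nat _ (leq_subr k N)) //= [X in _ = _ + X]big_nat_cond.
rewrite [X in _ = _ + X]big1 ?addr0 // => l /andP[/andP[lel _] _].
have [ltk|lek] := ltnP (size u) k.
  by rewrite [P k u](order_ge_divided p0 ltk) mul0r.
rewrite [P l v](order_ge_divided p0) ?mulr0 //.
apply: leq_trans lel; rewrite leq_subRL; last by rewrite (leq_trans lek) // /N -addnS leq_addr.
by rewrite addnS ltnS leq_add2r.
Qed.

End Coproduct.

(** ** Primitive homogeneous polynomials are Lie polynomials *)

Section Dynkin.
Variable A : finType.
Implicit Types (f g p : ncseries A) (u v w : seq A).

Definition word w : ncseries A := \prod_(a <- w) letter a.

(** Right-normed iterated bracket; words of one letter are a separate case, as
    the bracket with the value 0 at the empty word would vanish. *)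
Fixpoint dynkin w : ncseries A :=
  if w is a :: w' then
    if w' is [::] then letter a else lie (letter a) (dynkin w')
  else 0.

Lemma dynkin_cons a w :
  dynkin (a :: w) = ((nilp w)%:R : rat) *: letter a + lie (letter a) (dynkin w).
Proof.
case: w => [|b w] /=; first by rewrite scale1r lie0r addr0.
by rewrite scale0r add0r.
Qed.

Lemma dynkin_lie_poly w : lie_poly (dynkin w).
Proof.
elim: w => [|a w IH]; first exact: LiePoly0.
rewrite dynkin_cons; apply: LiePolyD; last by apply: LiePolyLie => //; exact: LiePolyLetter.
by apply: LiePolyZ; exact: LiePolyLetter.
Qed.

Lemma sum_unshuffles_nil w :
  \sum_(q <- unshuffles w) ((nilp q.1)%:R : rat) *: word q.2 = word w.
Proof.
elim: w => [|a w IH] /=; first by rewrite big_seq1 scale1r.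
rewrite big_cat !big_map /= big1 => [|q _]; last by rewrite scale0r.
rewrite add0r /word big_cons -/(word w) -IH mulr_sumr.
by apply: eq_bigr => q _; rewrite big_cons scalerAr.
Qed.

(** Dynkin's identity: the convolution of the right-normed bracketing with the
    identity is the Euler operator. Adding a letter a in front of a word, the
    unshuffles that put a in the second factor cancel against the negative half
    of the brackets [lie a _] of the others. *)
Lemma dynkin_unshuffles w :
  \sum_(q <- unshuffles w) dynkin q.1 * word q.2 = ((size w)%:R : rat) *: word w.
Proof.
elim: w => [|a w IH] /=; first by rewrite big_seq1 mul0r scale0r.
rewrite big_cat !big_map /= -big_split /=.
transitivity (letter a * \sum_(q <- unshuffles w)
    (((nilp q.1)%:R : rat) *: word q.2 + dynkin q.1 * word q.2)).
  rewrite mulr_sumr; apply: eq_bigr => q _.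
  rewrite -[if _ is [::] then _ else _]/(dynkin (a :: q.1)) dynkin_cons.
  rewrite mulrDl /lie mulrBl /word big_cons mulrDr -addrA; congr (_ + _).
    by rewrite -scalerAl -scalerAr.
  by rewrite !mulrA subrK.
rewrite big_split /= sum_unshuffles_nil IH /word big_cons mulrDr -scalerAr.
by rewrite -add1n natrD scalerDl scale1r.
Qed.

Lemma size_unshuffles w q :
  q \in unshuffles w -> (size q.1 + size q.2 = size w)%N.
Proof.
elim: w q => [|a w IH] q /=; first by rewrite inE => /eqP->.
by rewrite mem_cat => /orP[] /mapP[q' /IH <- ->] /=; rewrite ?addnS.
Qed.

Lemma sum_tuple_pick (V : lmodType rat) n w0 (F : seq A -> V) : size w0 = n ->
  \sum_(w : n.-tuple A) ((w == w0 :> seq A)%:R : rat) *: F w = F w0.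
Proof.
move=> szw; case: _ / szw; rewrite (bigD1 (in_tuple w0)) //= eqxx scale1r.
by rewrite big1 ?addr0 // => w /negPf ww0; rewrite (_ : _ == _ = false) ?scale0r.
Qed.

Lemma sum_pair_pick (V : lmodType rat) n (q : seq A * seq A)
    (G : seq A -> seq A -> V) : (size q.1 + size q.2 = n)%N ->
  \sum_(k < n.+1) \sum_(u : k.-tuple A) \sum_(v : (n - k).-tuple A)
    (((u : seq A), (v : seq A)) == q)%:R *: G u v = G q.1 q.2.
Proof.
case: q => u0 v0 /= szq; have ltu : (size u0 < n.+1)%N by rewrite -szq ltnS leq_addr.
rewrite (bigD1 (Ordinal ltu)) //= [X in _ + X]big1 ?addr0 => [|k ku]; last first.
  rewrite big1 // => u _; rewrite big1 // => v _; rewrite xpair_eqE.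
  case: eqP => [uu0|_]; last by rewrite scale0r.
  by case/eqP: ku; apply: val_inj; rewrite /= -uu0 size_tuple.
rewrite -(sum_tuple_pick (fun u => G u v0) (erefl (size u0))).
apply: eq_bigr => u _; rewrite -(sum_tuple_pick (n := n - size u0) (G u)); last first.
  by rewrite -szq addKn.
rewrite scaler_sumr; apply: eq_bigr => v _.
by rewrite xpair_eqE scalerA -natrM mulnb.
Qed.

(** The coproduct of a series, defined through coefficients, is the linear
    extension of unshuffling of words. *)
Lemma sum_coproduct (V : lmodType rat) n p (G : seq A -> seq A -> V) :
  \sum_(w : n.-tuple A) p w *: \sum_(q <- unshuffles w) G q.1 q.2 =
  \sum_(k < n.+1) \sum_(u : k.-tuple A) \sum_(v : (n - k).-tuple A)
    coproduct p u v *: G u v.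
Proof.
transitivity (\sum_(w : n.-tuple A) \sum_(k < n.+1) \sum_(u : k.-tuple A)
    \sum_(v : (n - k).-tuple A)
    (p w * (count_mem ((u : seq A), (v : seq A)) (unshuffles w))%:R) *: G u v).
  apply: eq_bigr => w _; rewrite big_seq_cond.
  under eq_bigr => q do [rewrite andbT => /size_unshuffles;
    rewrite size_tuple => /sum_pair_pick <-].
  rewrite -big_seq_cond exchange_big scaler_sumr; apply: eq_bigr => k _ /=.
  rewrite exchange_big scaler_sumr; apply: eq_bigr => u _ /=.
  rewrite exchange_big scaler_sumr; apply: eq_bigr => v _ /=.
  rewrite -scaler_suml scalerA; congr (_ * _ *: _).
  rewrite -natr_sum -sum1_count [in RHS]big_mkcond; congr _%:R.
  by apply: eq_bigr => q _; rewrite /= eq_sym; case: (q == _).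
rewrite exchange_big; apply: eq_bigr => k _ /=.
rewrite exchange_big; apply: eq_bigr => u _ /=.
rewrite exchange_big; apply: eq_bigr => v _ /=.
rewrite -scaler_suml; congr (_ *: _); rewrite /coproduct !size_tuple subnKC //.
by rewrite -ltnS.
Qed.

Definition homogeneous n p := forall w, size w != n -> p w = 0.

Lemma homogeneous_word n p : homogeneous n p ->
  p = \sum_(w : n.-tuple A) p w *: word w.
Proof.
move=> hp; apply: order_ge_eq => N; apply: (order_geW (leq_maxl N n.+1)).
set M := maxn N n.+1; have ltM : (n < M)%N by rewrite leq_max ltnSn orbT.
have trunc := @ncsubst_trunc _ _ (@letter A) (fun=> erefl) M p.
move: trunc; rewrite ncsubst_id (bigD1 (Ordinal ltM)) //= [X in _ - (_ + X)]big1 ?addr0 //.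
move=> k kn; rewrite big1 // => w _; rewrite hp ?scale0r // size_tuple.
by apply: contra kn => /eqP kn; apply/eqP/val_inj.
Qed.

(** The coproduct of a primitive element has no mixed terms, so Dynkin's
    identity writes it as a combination of iterated brackets. *)
Lemma primitive_lie_poly n p : (0 < n)%N -> homogeneous n p ->
  (forall u v, (size u + size v)%N = n -> u != [::] -> v != [::] ->
     coproduct p u v = 0) ->
  lie_poly p.
Proof.
move=> n_gt0 hp prim_p.
have n_unit : n%:R != 0 :> rat by rewrite Num.Theory.pnatr_eq0 -lt0n.
have np : n%:R *: p = \sum_(w : n.-tuple A) p w *: dynkin w.
  rewrite {1}(homogeneous_word hp) scaler_sumr.
  transitivity (\sum_(w : n.-tuple A) p w *:
      \sum_(q <- unshuffles w) dynkin q.1 * word q.2).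
    apply: eq_bigr => w _; rewrite dynkin_unshuffles size_tuple !scalerA.
    by rewrite mulrC.
  rewrite (sum_coproduct n p (fun u v => dynkin u * word v)) big_ord_recr /=.
  rewrite big1 ?add0r => [|k _].
    apply: eq_bigr => u _; rewrite subnn.
    rewrite (sum_tuple0 (fun v => coproduct p u v *: (dynkin u * word v))).
    by rewrite coproduct_nilr /word big_nil mulr1.
  rewrite big1 // => u _; rewrite big1 // => v _.
  have [->|u_neq0] := eqVneq (u : seq A) [::]; first by rewrite mul0r scaler0.
  rewrite prim_p ?scale0r ?size_tuple ?subnKC //; first by rewrite ltnW.
  by rewrite -size_eq0 size_tuple subn_eq0 -ltnNge.
rewrite -[p]scale1r -(mulVf n_unit) -scalerA np; apply: LiePolyZ.
elim/big_ind: _ => [||w _]; [exact: LiePoly0 | exact: LiePolyD |].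
by apply: LiePolyZ; exact: dynkin_lie_poly.
Qed.

End Dynkin.

(** ** Group-like series are exponentials of Lie series *)

Section Logarithm.
Variable A : finType.
Implicit Types (f g p x y phi : ncseries A).

Definition homogeneous_part n f : ncseries A :=
  fun w => if size w == n then f w else 0.

(** The part of degree n of the error made by the previous approximation is the
    correction to be added in degree n. *)
Fixpoint log_approx phi n : ncseries A :=
  if n is m.+1 then
    log_approx phi m +
      homogeneous_part n (phi - ncexp (log_approx phi m))
  else 0.

Definition nclog phi : ncseries A := fun w => log_approx phi (size w) w.

Lemma homogeneous_part_order n f : order_ge n (homogeneous_part n f).
Proof. by move=> w ltw; rewrite /homogeneous_part ltn_eqF. Qed.

Lemma order_geB_part n f : order_ge n f ->
  order_ge n.+1 (f - homogeneous_part n f).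
Proof.
move=> fn w; rewrite ltnS leq_eqVlt ncBE /homogeneous_part.
by case: eqP => [_ _|_ /= ltw]; rewrite ?subrr // fn ?subr0.
Qed.

Lemma order_ge_expS n k x y : x [::] = 0 -> y [::] = 0 ->
  order_ge n (x - y) -> order_ge (n + k) (x ^+ k.+1 - y ^+ k.+1).
Proof.
move=> x0 y0 xy; elim: k => [|k IH]; first by rewrite addn0 !expr1.
rewrite exprS [y ^+ _]exprS -(subrKA (x * y ^+ k.+1)) -mulrBl -mulrBr.
apply: order_geD; last by apply: order_geM => //; exact: order_geX.
by rewrite addnS -add1n; apply: order_geM => //; exact: order_ge1.
Qed.

(** The powers of x above the first do not feel q in degree n + 1, since each of
    the other factors contributes at least one to the degree. *)
Lemma ncexp_first_order n x q : x [::] = 0 -> order_ge n.+1 q ->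
  order_ge n.+2 (ncexp (x + q) - ncexp x - q).
Proof.
move=> x0 qn; have q0 : q [::] = 0 by exact: qn.
have xq0 : (x + q) [::] = 0 by rewrite ncDE x0 q0 addr0.
have xq : order_ge n.+1 (x + q - x) by rewrite addrAC subrr add0r.
apply: (@order_ge_trans _ _ _ (\sum_(k < n.+2) divided_power (x + q) k -
                               \sum_(k < n.+2) divided_power x k)).
  by rewrite opprD addrACA -opprD; apply: order_geB; exact: ncexp_divided.
rewrite -sumrB !big_ord_recl /divided_power /= !invr1 !scale1r !expr0 !expr1.
rewrite subrr add0r [x + q - x]addrAC subrr add0r addrAC subrr add0r.
apply: order_ge_sum => k _; rewrite -scalerBr; apply: order_geZ.
apply: (order_geW _ (order_ge_expS xq0 x0 xq)).
by rewrite addnS addSn !ltnS leq_addr.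
Qed.

(** Two group-like series that agree up to degree n have a difference that is
    primitive in degree n + 1, since the mixed coefficients of the coproducts are
    products of coefficients of lower degree. This makes the correction a Lie
    polynomial. *)
Lemma log_approx_correct phi n : grouplike phi ->
  lie_poly (log_approx phi n) /\ order_ge n.+1 (phi - ncexp (log_approx phi n)).
Proof.
move=> [phi1 Dphi]; elim: n => [|n [lie_p order_d]].
  split; first exact: LiePoly0.
  by apply: order_ge1; rewrite ncBE phi1 ncexp_nil subrr.
set p := log_approx phi n in lie_p order_d *.
set q := homogeneous_part n.+1 (phi - ncexp p).
have p0 := lie_poly_nil lie_p.
have [_ Dexp] := ncexp_grouplike (lie_poly_primitive lie_p) p0.
have order_q : order_ge n.+1 q by exact: homogeneous_part_order.
have lie_q : lie_poly q.
  apply: (@primitive_lie_poly _ n.+1) => // [w /negPf szw|u v szuv u_neq0 v_neq0].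
    by rewrite /q /homogeneous_part szw.
  rewrite (@coproduct_local _ _ (phi - ncexp p)) => [|w].
    have agree w : (size w < n.+1)%N -> phi w = ncexp p w.
      by move=> ltw; apply/eqP; rewrite -subr_eq0; apply/eqP; exact: order_d.
    rewrite coproductB Dphi Dexp !agree ?subrr // -szuv.
      by rewrite -[X in (X < _)%N]add0n ltn_add2r lt0n size_eq0.
    by rewrite -[X in (X < _)%N]addn0 ltn_add2l lt0n size_eq0.
  by rewrite szuv /q /homogeneous_part => ->; rewrite eqxx.
split; first exact: LiePolyD.
rewrite /= -/p -/q; apply: (@order_ge_trans _ _ _ (ncexp p + q)).
  by rewrite opprD addrA; exact: order_geB_part.
apply: order_ge_sym; rewrite opprD addrA; exact: ncexp_first_order.
Qed.

Lemma nclog_approx phi n : order_ge n.+1 (nclog phi - log_approx phi n).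
Proof.
have step m k : order_ge m.+1 (log_approx phi (m + k) - log_approx phi m).
  elim: k => [|k IH]; first by rewrite addn0 subrr.
  rewrite addnS /= addrAC; apply: order_geD => //.
  by apply: (order_geW _ (@homogeneous_part_order _ _)); rewrite ltnS leq_addr.
move=> w; rewrite ltnS ncBE /nclog => lew.
rewrite -(subnKC lew); apply/eqP; rewrite subr_eq0 eq_sym -subr_eq0.
by apply/eqP; exact: (step _ _ _ (ltnSn _)).
Qed.

Theorem grouplike_exp phi : grouplike phi ->
  lie_series (nclog phi) /\ phi = ncexp (nclog phi).
Proof.
move=> gphi; split.
  apply/nc_closureP => n; exists (log_approx phi n).
    by have [] := log_approx_correct n gphi.
  by apply: (order_geW (leqnSn n)); exact: nclog_approx.
apply: order_ge_eq => n; have [lie_p order_d] := log_approx_correct n gphi.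
have p0 := lie_poly_nil lie_p.
apply: (order_geW (leqnSn n)); apply: (order_ge_trans order_d).
apply: ncexp_order => //; last by apply: order_ge_sym; exact: nclog_approx.
Qed.

End Logarithm.

Section LieSeries.
Variable A : finType.
Implicit Types x y : ncseries A.

Lemma lie_poly_series x : lie_poly x -> lie_series x.
Proof. by move=> px n; exists x. Qed.

Lemma lie_series_nil x : lie_series x -> x [::] = 0.
Proof. by case/(_ 0) => y py ->//; exact: lie_poly_nil. Qed.

Lemma lie_seriesD x y : lie_series x -> lie_series y -> lie_series (x + y).
Proof.
move=> sx sy n; have [x' px xx'] := sx n; have [y' py yy'] := sy n.
exists (x' + y') => [|w lew]; first exact: LiePolyD.
by rewrite !ncDE xx' ?yy'.
Qed.

End LieSeries.

(** ** Linear parts and values of Lie series *)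

Section LinearPart.
Variable A : finType.
Implicit Types p : ncseries A.

Lemma lie_poly_linear p : lie_poly p ->
  exists2 s : seq (ncseries A * ncseries A),
    (forall q, q \in s -> lie_series q.1 /\ lie_series q.2) &
    p = \sum_a p [:: a] *: letter a + \sum_(q <- s) lie q.1 q.2.
Proof.
elim=> [|a|x y px [s Hs Ex] py [s' Hs' Ey]|c x px [s Hs Ex]|x y px _ py _].
- by exists [::] => //; rewrite big_nil big1 ?addr0 // => a _; rewrite scale0r.
- exists [::] => //; rewrite big_nil addr0 (bigD1 a) //= /letter eqxx scale1r.
  rewrite big1 ?addr0 // => b /negPf ba; rewrite (_ : [:: b] == [:: a] = false).
    by rewrite scale0r.
  by rewrite eqseq_cons ba.
- exists (s ++ s') => [q|]; first by rewrite mem_cat => /orP[/Hs|/Hs'].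
  rewrite big_cat /= {1}Ex {1}Ey addrACA -big_split; congr (_ + _).
  by apply: eq_bigr => a _; rewrite ncDE scalerDl.
- exists [seq (c *: q.1, q.2) | q <- s] => [_ /mapP[q /Hs[q1 q2] ->]|].
    by split=> // n; have [y py qy] := q1 n; exists (c *: y);
      [exact: LiePolyZ | move=> w lew; rewrite /= !ncZE qy].
  rewrite big_map {1}Ex scalerDr !scaler_sumr; congr (_ + _).
    by apply: eq_bigr => a _; rewrite ncZE scalerA.
  by apply: eq_bigr => q _; rewrite lieZl.
- exists [:: (x, y)] => [q|]; first by rewrite inE => /eqP->; split; exact: lie_poly_series.
  rewrite big_seq1 big1 ?add0r // => a _.
  by rewrite lie_letter ?scale0r //; exact: lie_poly_nil.
Qed.

(** Commuting values leave only the linear part of a Lie series. *)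
Lemma lie_series_abelian B (s : A -> ncseries B) p : lie_series p ->
  (forall a, s a [::] = 0) -> (forall a b, lie (s a) (s b) = 0) ->
  ncsubst s p = \sum_a p [:: a] *: s a.
Proof.
move=> sp s0 s_comm; apply: order_ge_eq => n.
have [y py pyn] := (nc_closureP _ _).1 sp n.+2.
have -> : \sum_a p [:: a] *: s a = ncsubst s y; last first.
  by rewrite -ncsubstB; apply: ncsubst_order; apply: (@order_geW _ n n.+2) => //;
     rewrite ltnW.
have -> : \sum_a p [:: a] *: s a = \sum_a y [:: a] *: s a.
  apply: eq_bigr => a _; congr (_ *: _); apply/eqP; rewrite -subr_eq0.
  by apply/eqP; exact: (pyn [:: a]).
elim: py {pyn} => [|a|x x' _ IH _ IH'|c x _ IH|x x' px IH px' IH'].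
- by rewrite ncsubst0 big1 // => a _; rewrite scale0r.
- rewrite ncsubst_letter // (bigD1 a) //= /letter eqxx scale1r.
  rewrite big1 ?addr0 // => b /negPf ba; rewrite (_ : [:: b] == [:: a] = false).
    by rewrite scale0r.
  by rewrite eqseq_cons ba.
- rewrite ncsubstD -IH -IH' -big_split; apply: eq_bigr => a _.
  by rewrite ncDE scalerDl.
- rewrite ncsubstZ -IH scaler_sumr; apply: eq_bigr => a _.
  by rewrite ncZE scalerA.
- rewrite ncsubst_lie // -IH -IH' big1 => [|a _]; last first.
    by rewrite lie_letter ?scale0r //; exact: lie_poly_nil.
  symmetry; elim/big_ind: _ => [|u v u0 v0|a _]; first by rewrite lie0l.
    by rewrite lieDl u0 v0 addr0.
  rewrite lieZl; elim/big_ind: _ => [|u v u0 v0|b _].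
  + by rewrite lie0r scaler0.
  + by rewrite lieDr scalerDr u0 v0 addr0.
  + by rewrite lieZr s_comm !scaler0.
Qed.

End LinearPart.

(** A Lie polynomial is the sum of its linear part and of brackets. *)
Lemma lie_series_commutator alpha : lie_series alpha ->
  alpha [:: false] = 0 -> alpha [:: true] = 0 -> commutator_lielike alpha.
Proof.
move=> sa a0 a1; split=> //; apply/nc_closureP => n.
have [y py ayn] := (nc_closureP _ _).1 sa n.+2.
exists y; last by apply: (@order_geW _ n n.+2) => //; rewrite ltnW.
have [s Hs Ey] := lie_poly_linear py; exists s => //.
rewrite {1}Ey big1 ?add0r // => a _.
have -> : y [:: a] = alpha [:: a].
  by apply/esym/eqP; rewrite -subr_eq0; apply/eqP; exact: (ayn [:: a]).
by case: a; rewrite ?a0 ?a1 scale0r.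
Qed.

(** ** Central corrections in Lie series *)

Record lie_ideal (B : eqType) (J : ncseries B -> Prop) : Prop := LieIdeal {
  lie_ideal0 : J 0;
  lie_idealD : forall x y, J x -> J y -> J (x + y);
  lie_idealZ : forall c x, J x -> J (c *: x);
  lie_idealL : forall x y, lie_poly x -> J y -> J (lie x y) }.

Section LieIdeal.
Variables (B : eqType) (J : ncseries B -> Prop).
Hypothesis J_ideal : lie_ideal J.

Lemma lie_idealN x : J x -> J (- x).
Proof. by rewrite -scaleN1r; exact: (lie_idealZ J_ideal). Qed.

Lemma lie_idealB x y : J x -> J y -> J (x - y).
Proof. by move=> Jx Jy; apply: (lie_idealD J_ideal) => //; exact: lie_idealN. Qed.

Lemma lie_idealR x y : J x -> lie_poly y -> J (lie x y).
Proof.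
by move=> Jx py; rewrite lieC; apply: lie_idealN; exact: (lie_idealL J_ideal).
Qed.

Lemma lie_poly_ncsubst (A : finType) (s : A -> ncseries B) p :
  (forall a, lie_poly (s a)) -> lie_poly p -> lie_poly (ncsubst s p).
Proof.
move=> ps; have s0 a : s a [::] = 0 by exact: lie_poly_nil.
elim=> [|a|x y _ px _ py|c x _ px|x y _ px _ py].
- by rewrite ncsubst0; exact: LiePoly0.
- by rewrite ncsubst_letter.
- by rewrite ncsubstD; exact: LiePolyD.
- by rewrite ncsubstZ; exact: LiePolyZ.
- by rewrite ncsubst_lie //; exact: LiePolyLie.
Qed.

Variables (A : finType) (s s' : A -> ncseries B).
Variables (k : A -> rat) (z : ncseries B).
Hypotheses (ps : forall a, lie_poly (s a)) (ps' : forall a, lie_poly (s' a)).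
Hypotheses (pz : lie_poly z) (Jsz : forall a, J (lie z (s a))).
Hypothesis Js : forall a, J (s' a - s a - k a *: z).

Let s_nil a : s a [::] = 0. Proof. exact: lie_poly_nil. Qed.
Let s'_nil a : s' a [::] = 0. Proof. exact: lie_poly_nil. Qed.

Lemma lie_poly_central p : lie_poly p -> J (lie z (ncsubst s p)).
Proof.
elim=> [|a|x y _ Jx _ Jy|c x _ Jx|x y px Jx py Jy].
- by rewrite ncsubst0 lie0r; exact: (lie_ideal0 J_ideal).
- by rewrite ncsubst_letter.
- by rewrite ncsubstD lieDr; exact: (lie_idealD J_ideal).
- by rewrite ncsubstZ lieZr; exact: (lie_idealZ J_ideal).
- rewrite ncsubst_lie // jacobi; apply: (lie_idealD J_ideal).
    by apply: lie_idealR => //; exact: lie_poly_ncsubst.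
  by apply: (lie_idealL J_ideal) => //; exact: lie_poly_ncsubst.
Qed.

(** Brackets kill central elements, so that changing the arguments of a Lie
    polynomial by multiples of an element commuting with them only affects its
    linear part. *)
Lemma lie_poly_shift p : lie_poly p ->
  J (ncsubst s' p - ncsubst s p - (\sum_a p [:: a] * k a) *: z).
Proof.
elim=> [|a|x y px Jx py Jy|c x px Jx|x y px Jx py Jy].
- rewrite !ncsubst0 subrr big1 => [|a _]; last by rewrite mul0r.
  by rewrite scale0r subrr; exact: (lie_ideal0 J_ideal).
- rewrite !ncsubst_letter // (bigD1 a) //= /letter eqxx mul1r.
  rewrite big1 ?addr0 // => b /negPf ba; rewrite (_ : [:: b] == [:: a] = false).
    by rewrite mul0r.
  by rewrite eqseq_cons ba.
- have -> : \sum_a (x + y) [:: a] * k a =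
      \sum_a x [:: a] * k a + \sum_a y [:: a] * k a.
    by rewrite -big_split; apply: eq_bigr => a _; rewrite ncDE mulrDl.
  rewrite !ncsubstD scalerDl !opprD [X in J (X + _)]addrACA [X in J X]addrACA.
  exact: (lie_idealD J_ideal).
- have -> : \sum_a (c *: x) [:: a] * k a = c * \sum_a x [:: a] * k a.
    by rewrite mulr_sumr; apply: eq_bigr => a _; rewrite ncZE mulrA.
  rewrite !ncsubstZ -scalerA -!scalerBr; exact: (lie_idealZ J_ideal).
- have px' := lie_poly_ncsubst ps px; have py' := lie_poly_ncsubst ps' py.
  rewrite big1 => [|a _]; last first.
    by rewrite lie_letter ?mul0r //; exact: lie_poly_nil.
  rewrite scale0r subr0 !ncsubst_lie //.
  set X := ncsubst s x in Jx px' *; set X' := ncsubst s' x in Jx *.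
  set Y := ncsubst s y in Jy *; set Y' := ncsubst s' y in Jy py' *.
  set kx := \sum_a _ in Jx; set ky := \sum_a _ in Jy.
  have JzX : J (lie z X) by exact: lie_poly_central.
  have JzY' : J (lie z Y').
    rewrite -(subrK (ky *: z) Y') -(subrK Y (Y' - _)) lieDr [X in X + _]lieDr.
    apply: (lie_idealD J_ideal); last first.
      by rewrite lieZr liexx scaler0; exact: (lie_ideal0 J_ideal).
    apply: (lie_idealD J_ideal); last exact: lie_poly_central.
    by rewrite addrAC; exact: (lie_idealL J_ideal).
  have -> : lie X' Y' - lie X Y =
      lie (X' - X - kx *: z) Y' + kx *: lie z Y' +
      (lie X (Y' - Y - ky *: z) - ky *: lie z X).
    rewrite -lieZl -lieDl subrK -[- (ky *: lie z X)]scalerN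
      -[- lie z X]lieC -lieZr -lieDr subrK.
    by rewrite lieBl lieBr subrKA.
  apply: (lie_idealD J_ideal).
    apply: (lie_idealD J_ideal); first exact: lie_idealR.
    exact: (lie_idealZ J_ideal).
  apply: lie_idealB; first exact: (lie_idealL J_ideal).
  exact: (lie_idealZ J_ideal).
Qed.

Lemma lie_series_shift p : lie_series p -> \sum_a p [:: a] * k a = 0 ->
  nc_closure J (ncsubst s' p - ncsubst s p).
Proof.
move=> sp kp; apply/nc_closureP => n.
have [y py pyn] := (nc_closureP _ _).1 sp n.+2.
exists (ncsubst s' y - ncsubst s y).
  have := lie_poly_shift py.
  have <- : \sum_a p [:: a] * k a = \sum_a y [:: a] * k a.
    apply: eq_bigr => a _; congr (_ * _).
    by apply/eqP; rewrite -subr_eq0; apply/eqP; exact: (pyn [:: a]).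
  by rewrite kp scale0r subr0.
rewrite opprD addrACA -opprD -!ncsubstB.
have pyn' : order_ge n (p - y).
  by apply: (@order_geW _ n n.+2) => //; rewrite ltnW.
by apply: order_geB; exact: ncsubst_order.
Qed.

End LieIdeal.

(** * The Lie algebra of infinitesimal braids *)

Lemma t4_lie_ideal : lie_ideal t4_ideal.
Proof.
split; [exact: T4Ideal0 | exact: T4IdealD | exact: T4IdealZ | exact: T4IdealLie].
Qed.

Lemma Ut4_idealM a x b : Ut4_ideal x -> Ut4_ideal (a * x * b).
Proof.
elim=> [|a' r b' rr|y z _ Iy _ Iz]; first by rewrite mulr0 mul0r; exact: Ut4Ideal0.
  by rewrite !mulrA -mulrA; exact: Ut4IdealRel.
by rewrite mulrDr mulrDl; exact: Ut4IdealD.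
Qed.

Lemma t4_ideal_sub x : t4_ideal x -> Ut4_ideal x.
Proof.
have IM a y b : Ut4_ideal y -> Ut4_ideal (a * y * b) by exact: Ut4_idealM.
elim=> [|r rr|y z _ Iy _ Iz|c y _ Iy|y z _ _ Iz].
- exact: Ut4Ideal0.
- by rewrite -[r]mul1r -[1 * r]mulr1; exact: Ut4IdealRel.
- exact: Ut4IdealD.
- by rewrite -[y]mul1r scalerAl -[X in Ut4_ideal X]mulr1; exact: IM.
- rewrite /lie -[y * z]mulr1 -mulNr -[- z * y]mul1r mulrA mulrN -mulNr.
  by apply: Ut4IdealD; exact: IM.
Qed.

Lemma Ut4_closed : closed_ideal (nc_closure Ut4_ideal).
Proof.
split=> [n|x y Ix Iy n|a x b /nc_closureP Ix|x Ix].
- by exists 0; [exact: Ut4Ideal0 |].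
- have [x' Ix' xx'] := Ix n; have [y' Iy' yy'] := Iy n.
  by exists (x' + y') => [|w lew]; [exact: Ut4IdealD | rewrite !ncDE xx' ?yy'].
- apply/nc_closureP => n; have [y Iy xy] := Ix n.
  exists (a * y * b); first exact: Ut4_idealM.
  by rewrite -mulrBl -mulrBr; apply: order_geMr; exact: order_geMl.
- apply/nc_closureP => n; have [y /nc_closureP Iy xy] := Ix n.
  have [y' Iy' yy'] := Iy n; exists y' => //.
  exact: order_ge_trans xy yy'.
Qed.

Lemma t4_closure_sub x : nc_closure t4_ideal x -> nc_closure Ut4_ideal x.
Proof. by move=> Ix n; have [y Iy xy] := Ix n; exists y => //; exact: t4_ideal_sub. Qed.

Lemma eq_mod_Ut4 x y :
  (x = y %[mod Ut4_hat]) <-> nc_closure Ut4_ideal (x - y).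
Proof.
by split=> [/eqP|I]; [|apply/eqP]; rewrite -Quotient.idealrBE;
  [move/asboolP | apply/asboolP].
Qed.

Lemma eq_mod_t4 x y :
  (x = y %[mod t4_hat]) <-> nc_closure t4_ideal (x - y).
Proof.
by split=> [/eqP|I]; [|apply/eqP]; rewrite -Quotient.idealrBE;
  [move/asboolP | apply/asboolP].
Qed.

(** ** Commutation relations *)

Lemma t_lie_poly i j : lie_poly (t i j).
Proof. exact: LiePolyLetter. Qed.

(** Allows the relations to be written with increasing pairs of indices only. *)
Lemma t4_triple_sort a b c d e f :
  t4_ideal (lie (t a b) (t c d + t e f)) ->
  t4_ideal (lie (t a b) (t c d + t f e)).
Proof.
move=> rel; rewrite (_ : t f e = t e f + (t f e - t e f)); last by rewrite addrC subrK.
rewrite addrA lieDr; apply: T4IdealD => //.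
by apply: T4IdealLie; [exact: t_lie_poly | apply: T4IdealRel; exact: T4Sym].
Qed.

Section Relations.
Variables i j k : 'I_4.
Hypothesis ijk_uniq : uniq [:: i; j; k].

Lemma t4_triple12 : t4_ideal (lie (t i j) (t i k + t j k)).
Proof. by apply: T4IdealRel; exact: T4Triple. Qed.

Lemma t4_triple13 : t4_ideal (lie (t i k) (t i j + t j k)).
Proof.
apply: t4_triple_sort; apply: T4IdealRel; apply: T4Triple.
by move: ijk_uniq; rewrite /= !inE !negb_or !andbT [k == j]eq_sym => /andP[/andP[-> ->] ->].
Qed.

Lemma t4_triple23 : t4_ideal (lie (t j k) (t i j + t i k)).
Proof.
apply: t4_triple_sort; rewrite addrC; apply: t4_triple_sort; rewrite addrC.
apply: T4IdealRel; apply: T4Triple; move: ijk_uniq; rewrite /= !inE !negb_or !andbT.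
by rewrite [j == i]eq_sym [k == i]eq_sym => /andP[/andP[-> ->] ->].
Qed.

End Relations.

Local Notation i0 := (inord 0 : 'I_4).
Local Notation i1 := (inord 1 : 'I_4).
Local Notation i2 := (inord 2 : 'I_4).
Local Notation i3 := (inord 3 : 'I_4).

Local Ltac inord_neq := rewrite /= ?inE -?val_eqE /= ?inordK.

(* Identities between linear combinations are checked on each coefficient, after
   generalization of the elements they involve. *)
Local Ltac nc_linear :=
  apply: funext => w; rewrite ?ncE;
  repeat match goal with
  | |- context [lie ?x ?y ?w] => generalize (lie x y w)
  | |- context [t ?i ?j ?w] => generalize (t i j w)
  end; intros; ring.

Lemma t4_disjoint i j k l : uniq [:: i; j; k; l] -> t4_ideal (lie (t i j) (t k l)).
Proof. by move=> ijkl; apply: T4IdealRel; exact: T4Disjoint. Qed.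

Lemma uniq012 : uniq [:: i0; i1; i2]. Proof. by inord_neq. Qed.
Lemma uniq013 : uniq [:: i0; i1; i3]. Proof. by inord_neq. Qed.
Lemma uniq023 : uniq [:: i0; i2; i3]. Proof. by inord_neq. Qed.
Lemma uniq123 : uniq [:: i1; i2; i3]. Proof. by inord_neq. Qed.

Lemma bracket_t01_t23 : t4_ideal (lie (t i0 i1) (t i2 i3)).
Proof. by apply: t4_disjoint; inord_neq. Qed.

Lemma bracket_t02_t13 : t4_ideal (lie (t i0 i2) (t i1 i3)).
Proof. by apply: t4_disjoint; inord_neq. Qed.

Lemma bracket_t03_t12 : t4_ideal (lie (t i0 i3) (t i1 i2)).
Proof. by apply: t4_disjoint; inord_neq. Qed.

(** The difference between the [f0]-arguments of the cablings 01,2,3 and 0,1,2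
    flipped, then of 0,1,23 and 0,12,3 flipped. The first is the central element
    of the algebra of the three strands 01, 2, 3; the second is the sum of [t23]
    and of the central element of the algebra of all four strands. *)
Definition flip_shift1 : ncseries t4_letter :=
  t i0 i2 + t i1 i2 + (t i0 i3 + t i1 i3 + t i2 i3).
Definition flip_shift2 : ncseries t4_letter :=
  t i0 i1 + (t i0 i3 + t i1 i3 + t i2 i3) + (t i0 i2 + t i1 i2 + t i2 i3).

Lemma flip_shift1_t23 : t4_ideal (lie flip_shift1 (t i2 i3)).
Proof.
have := lie_idealN t4_lie_ideal
  (T4IdealD (t4_triple23 uniq023) (t4_triple23 uniq123)).
congr t4_ideal; rewrite [RHS]lieC /flip_shift1 !lieDr liexx; nc_linear.
Qed.

Lemma flip_shift1_t012 : t4_ideal (lie flip_shift1 (t i0 i2 + t i1 i2)).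
Proof.
have := T4IdealD (lie_idealN t4_lie_ideal (T4IdealD
  (T4IdealD (t4_triple12 uniq023) (t4_triple12 uniq123)) bracket_t02_t13))
  bracket_t03_t12.
congr t4_ideal; rewrite [RHS]lieC /flip_shift1 [in RHS]lieDr liexx.
rewrite !lieDr !lieDl [lie (t i1 i2) (t i0 i3)]lieC; nc_linear.
Qed.

Lemma flip_shift2_t01 : t4_ideal (lie flip_shift2 (t i0 i1)).
Proof.
have := lie_idealN t4_lie_ideal (T4IdealD
  (T4IdealD (t4_triple12 uniq012) (t4_triple12 uniq013))
  (T4IdealD bracket_t01_t23 bracket_t01_t23)).
congr t4_ideal; rewrite [RHS]lieC /flip_shift2 !lieDr liexx; nc_linear.
Qed.

Lemma flip_shift2_t123 : t4_ideal (lie flip_shift2 (t i1 i2 + t i1 i3)).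
Proof.
have := lie_idealN t4_lie_ideal
  (T4IdealD (T4IdealD (lie_idealB t4_lie_ideal
      (T4IdealD (t4_triple23 uniq012) (t4_triple12 uniq123)) bracket_t03_t12)
    (T4IdealD (t4_triple23 uniq013) (t4_triple13 uniq123)))
    (lie_idealN t4_lie_ideal
      (T4IdealD bracket_t02_t13 (t4_triple23 uniq123)))).
congr t4_ideal; rewrite [RHS]lieC /flip_shift2 !lieDr !lieDl !liexx.
rewrite [lie (t i2 i3) (t i1 i2)]lieC [lie (t i2 i3) (t i1 i3)]lieC.
rewrite [lie (t i1 i2) (t i0 i3)]lieC [lie (t i1 i3) (t i0 i2)]lieC; nc_linear.
Qed.

(** ** Cablings *)

Definition pair_letters B (x y : ncseries B) (b : bool) : ncseries B :=
  if b then y else x.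

Lemma sum_set2 (V : nmodType) (a b : 'I_4) (F : 'I_4 -> V) : a != b ->
  \sum_(i in [set a; b]%SET) F i = F a + F b.
Proof. by move=> ab; rewrite big_setU1 ?inE //= big_set1. Qed.

Lemma cable01_2_3 phi : phi^{s01, s2, s3} =
  ncsubst (pair_letters (t i0 i2 + t i1 i2) (t i2 i3)) phi.
Proof.
congr ncsubst; apply: funext => -[] /=; rewrite /s01 /s2 /s3 ?big_set1 //.
by rewrite sum_set2 ?big_set1 //; inord_neq.
Qed.

Lemma cable0_1_23 phi : phi^{s0, s1, s23} =
  ncsubst (pair_letters (t i0 i1) (t i1 i2 + t i1 i3)) phi.
Proof.
congr ncsubst; apply: funext => -[] /=; rewrite /s0 /s1 /s23 ?big_set1 //.
by rewrite sum_set2 //; inord_neq.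
Qed.

Lemma cable0_1_2 phi : phi^{s0, s1, s2} =
  ncsubst (pair_letters (t i0 i1) (t i1 i2)) phi.
Proof.
by congr ncsubst; apply: funext => -[] /=; rewrite /s0 /s1 /s2 !big_set1.
Qed.

Lemma cable0_12_3 phi : phi^{s0, s12, s3} =
  ncsubst (pair_letters (t i0 i1 + t i0 i2) (t i1 i3 + t i2 i3)) phi.
Proof.
congr ncsubst; apply: funext => -[] /=; rewrite /s0 /s12 /s3.
  by rewrite sum_set2 ?big_set1 //; inord_neq.
by rewrite big_set1 sum_set2 //; inord_neq.
Qed.

Lemma cable1_2_3 phi : phi^{s1, s2, s3} =
  ncsubst (pair_letters (t i1 i2) (t i2 i3)) phi.
Proof.
by congr ncsubst; apply: funext => -[] /=; rewrite /s1 /s2 /s3 !big_set1.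
Qed.

Definition cableE :=
  (cable01_2_3, cable0_1_23, cable0_1_2, cable0_12_3, cable1_2_3).

Lemma pair_letters_nil B (x y : ncseries B) : x [::] = 0 -> y [::] = 0 ->
  forall b, pair_letters x y b [::] = 0.
Proof. by move=> x0 y0 []. Qed.

Lemma ncsubst_pair C (r : t4_letter -> ncseries C) x y phi :
  x [::] = 0 -> y [::] = 0 -> (forall a, r a [::] = 0) ->
  ncsubst r (ncsubst (pair_letters x y) phi) =
  ncsubst (pair_letters (ncsubst r x) (ncsubst r y)) phi.
Proof.
move=> x0 y0 r0; rewrite ncsubst_comp //; last exact: pair_letters_nil.
by congr ncsubst; apply: funext => -[].
Qed.

(** ** The flip *)

Lemma flip_letter_nil a : flip_letter a [::] = 0.
Proof.
case: a => i j; rewrite /flip_letter; case: eqP => _; case: eqP => _ //;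
by rewrite ncNE ncsumE big1 ?oppr0.
Qed.

Lemma sum_I4 (V : nmodType) (F : 'I_4 -> V) :
  \sum_k F k = F i0 + F i1 + F i2 + F i3.
Proof.
rewrite !big_ord_recl big_ord0 addr0 !addrA.
by congr (F _ + F _ + F _ + F _); apply: val_inj; rewrite /= inordK.
Qed.

Lemma rev4E k : (0 < k < 4)%N -> rev4 (inord k) = inord (4 - k).
Proof. by case/andP=> k_gt0 ltk; rewrite /rev4 inordK. Qed.

Lemma flip_t0 k : (0 < k < 4)%N -> flip (t i0 (inord k)) =
  - (t i0 (inord (4 - k)) + t i1 (inord (4 - k)) + t i2 (inord (4 - k)) +
     t i3 (inord (4 - k))).
Proof.
move=> k4; rewrite /flip ncsubst_letter; last exact: flip_letter_nil.
rewrite /flip_letter eqxx rev4E // sum_I4 ifF //.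
by case/andP: k4 => k0 k4; rewrite -val_eqE /= !inordK // gtn_eqF.
Qed.

Lemma flip_t j k : (0 < j < 4)%N -> (0 < k < 4)%N ->
  flip (t (inord j) (inord k)) = t (inord (4 - j)) (inord (4 - k)).
Proof.
move=> j4 k4; rewrite /flip ncsubst_letter; last exact: flip_letter_nil.
rewrite /flip_letter !rev4E //.
case/andP: j4 => j0 j4; case/andP: k4 => k0 k4.
by rewrite -!val_eqE /= !inordK // !gtn_eqF.
Qed.

Lemma lie_polyN p : lie_poly p -> lie_poly (- p : ncseries t4_letter).
Proof. by rewrite -scaleN1r; exact: LiePolyZ. Qed.

Local Ltac lie_poly_t :=
  repeat first [apply: lie_polyN | apply: LiePolyD | exact: t_lie_poly].

Section FlipOfCables.
Variable alpha : ncseries bool.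
Hypotheses (lie_alpha : lie_series alpha) (alpha_dagger : alpha [:: false] = 0).

(** The instance of [lie_series_shift] in which the first argument moves by the
    opposite of a commuting element z; only the coefficient of [f0] matters. *)
Lemma flip_cable (x y x' y' z : ncseries t4_letter) :
  lie_poly x -> lie_poly y -> lie_poly x' -> lie_poly y' -> lie_poly z ->
  t4_ideal (lie z x) -> t4_ideal (lie z y) ->
  t4_ideal (x' - x + z) -> t4_ideal (y' - y) ->
  nc_closure t4_ideal
    (ncsubst (pair_letters x' y') alpha - ncsubst (pair_letters x y) alpha).
Proof.
move=> px py px' py' pz zx zy xx yy.
pose k (b : bool) : rat := if b then 0 else -1.
apply: (lie_series_shift t4_lie_ideal (k := k) (z := z)) => //; try by case.
  by case=> /=; rewrite ?scale0r ?subr0 // scaleN1r opprK.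
by rewrite big1 // => -[] _; rewrite ?mulr0 // alpha_dagger mul0r.
Qed.

Lemma flip_cable0_1_2 :
  nc_closure t4_ideal (flip alpha^{s0, s1, s2} - alpha^{s01, s2, s3}).
Proof.
rewrite !cableE /flip ncsubst_pair //; last exact: flip_letter_nil.
rewrite -/(flip (t i0 i1)) -/(flip (t i1 i2)) flip_t0 // flip_t // !subSS !subn0.
apply: flip_cable flip_shift1_t012 flip_shift1_t23 _ _;
  rewrite /flip_shift1; try by lie_poly_t.
  (* The sum over k in the flip of t01 contains t33, which is a relator. *)
  have := lie_idealN t4_lie_ideal (T4IdealRel (T4Diag i3)).
  congr t4_ideal; nc_linear.
by apply: T4IdealRel; exact: T4Sym.
Qed.

Lemma flip_cable0_12_3 :
  nc_closure t4_ideal (flip alpha^{s0, s12, s3} - alpha^{s0, s1, s23}).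
Proof.
rewrite !cableE /flip ncsubst_pair //; last exact: flip_letter_nil.
rewrite !ncsubstD -/(flip (t i0 i1)) -/(flip (t i0 i2)) -/(flip (t i1 i3)).
rewrite -/(flip (t i2 i3)) !flip_t0 // !flip_t // !subSS !subn0.
apply: flip_cable flip_shift2_t01 flip_shift2_t123 _ _;
  rewrite /flip_shift2; try by lie_poly_t.
  have := T4IdealD (lie_idealN t4_lie_ideal (T4IdealD
    (T4IdealRel (T4Diag i3)) (T4IdealRel (T4Diag i2)))) (T4IdealRel (T4Sym i2 i3)).
  congr t4_ideal; nc_linear.
have := T4IdealD (T4IdealRel (T4Sym i3 i1)) (T4IdealRel (T4Sym i2 i1)).
congr t4_ideal; nc_linear.
Qed.

End FlipOfCables.

Lemma flip_cables_lie alpha : f2_hat_dagger alpha ->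
  nc_closure t4_ideal (flip (alpha^{s0, s1, s2} + alpha^{s0, s12, s3}) -
                       (alpha^{s01, s2, s3} + alpha^{s0, s1, s23})).
Proof.
case=> sa a0; rewrite /flip ncsubstD opprD addrACA => n.
have [x Jx xE] := flip_cable0_1_2 sa a0 n.
have [y Jy yE] := flip_cable0_12_3 sa a0 n.
by exists (x + y) => [|w lew]; [exact: T4IdealD | rewrite [RHS]ncDE -xE -?yE].
Qed.

Lemma cable_nil S0 S1 S2 f : f^{S0, S1, S2} [::] = f [::].
Proof.
apply: ncsubst_nil => -[];
by rewrite ncsumE big1 // => i _; rewrite ncsumE big1.
Qed.

Lemma cable_exp S0 S1 S2 (x : ncseries bool) : x [::] = 0 ->
  (ncexp x)^{S0, S1, S2} = ncexp x^{S0, S1, S2}.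
Proof.
move=> x0; apply: ncsubst_exp => // -[];
by rewrite ncsumE big1 // => i _; rewrite ncsumE big1.
Qed.

(** Follows from the Lie case, the logarithm of g having the same linear part as
    g. *)
Lemma flip_cables_grouplike g : exp_f2_hat_dagger g ->
  nc_closure Ut4_ideal (flip (g^{s0, s1, s2} * g^{s0, s12, s3}) -
                        g^{s01, s2, s3} * g^{s0, s1, s23}).
Proof.
case=> gg g0; have [sa Eg] := grouplike_exp gg.
set alpha := nclog g in sa Eg.
have a_nil := lie_series_nil sa.
have a0 : alpha [:: false] = 0 by rewrite -ncexp_letter -Eg.
rewrite /flip ncsubstM ?Eg; last exact: flip_letter_nil.
rewrite !cable_exp // !ncsubst_exp ?cable_nil //; try exact: flip_letter_nil.
apply: (ideal_mul Ut4_closed); apply: (ideal_ncexp Ut4_closed);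
  rewrite ?ncsubst_nil ?cable_nil //; try exact: flip_letter_nil.
  by apply: t4_closure_sub; exact: flip_cable0_1_2.
by apply: t4_closure_sub; exact: flip_cable0_12_3.
Qed.

(** * The pentagon up to an exponential *)

Definition pentagon g h := nc_closure Ut4_ideal
  (g^{s01, s2, s3} * g^{s0, s1, s23} -
   g^{s0, s1, s2} * g^{s0, s12, s3} * h^{s1, s2, s3}).

Definition lie_pentagon alpha beta := nc_closure t4_ideal
  (alpha^{s01, s2, s3} + alpha^{s0, s1, s23} -
   (alpha^{s0, s1, s2} + alpha^{s0, s12, s3} + beta^{s1, s2, s3})).

Lemma pair_t_nil (x y : ncseries t4_letter) : lie_poly x -> lie_poly y ->
  forall b, pair_letters x y b [::] = 0.
Proof. by move=> px py []; exact: lie_poly_nil. Qed.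

(** Used to gather the exponentials produced by [g * exp (c f1)] in a product of
    two cablings at its right end. *)
Lemma move_exp A (I : ncseries A -> Prop) (X1 X2 x y : ncseries A) : closed_ideal I ->
  x [::] = 0 -> y [::] = 0 -> I (lie x X2) -> I (lie x y) ->
  I (X1 * ncexp x * (X2 * ncexp y) - X1 * X2 * ncexp (x + y)).
Proof.
move=> cI x0 y0 xX xy; apply: (@ideal_trans _ _ cI (X1 * X2 * (ncexp x * ncexp y))).
  rewrite -!mulrA -mulrBr; apply: (idealMl cI); rewrite !mulrA -mulrBl.
  apply: (idealMr cI); rewrite -opprB; apply: (idealN cI).
  apply: (subalg_ncexp (centralizer_closed cI X2)) => //.
  by rewrite lieC; exact: (idealN cI).
rewrite -mulrBr; apply: (idealMl cI); apply: (ideal_sym cI).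
exact: ncexpD.
Qed.

Lemma cableM S0 S1 S2 f g : (f * g)^{S0, S1, S2} = f^{S0, S1, S2} * g^{S0, S1, S2}.
Proof.
by apply: ncsubstM => -[]; rewrite ncsumE big1 // => i _; rewrite ncsumE big1.
Qed.

Lemma Ut4_bracket x y : t4_ideal (lie x y) -> nc_closure Ut4_ideal (lie x y).
Proof. by move=> xy n; exists (lie x y) => //; exact: t4_ideal_sub. Qed.

Lemma commute_pair z x y phi : lie_poly x -> lie_poly y ->
  nc_closure Ut4_ideal (lie z x) -> nc_closure Ut4_ideal (lie z y) ->
  nc_closure Ut4_ideal (lie z (ncsubst (pair_letters x y) phi)).
Proof.
move=> px py zx zy; apply: (subalg_ncsubst (centralizer_closed Ut4_closed z)).
  exact: pair_t_nil.
by case.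
Qed.

Lemma cable_f1 c :
  [/\ (c *: f1)^{s01, s2, s3} = c *: t i2 i3,
      (c *: f1)^{s0, s1, s23} = c *: (t i1 i2 + t i1 i3),
      (c *: f1)^{s0, s1, s2} = c *: t i1 i2,
      (c *: f1)^{s0, s12, s3} = c *: (t i1 i3 + t i2 i3) &
      (c *: f1)^{s1, s2, s3} = c *: t i2 i3].
Proof.
by split; rewrite !cableE ncsubstZ ncsubst_letter //; apply: pair_t_nil;
  lie_poly_t.
Qed.

(** The exponential factors move to the right, where on both sides they combine
    into the exponential of the central element [t12 + t13 + t23] of the braid
    algebra of strands 1, 2, 3. *)
Lemma pentagon_exp c g h : pentagon g h -> pentagon (g * ncexp (c *: f1)) h.
Proof.
move=> pent; have I_closed := Ut4_closed.
pose Z := c *: (t i1 i2 + t i1 i3 + t i2 i3).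
have cf1_nil : (c *: f1) [::] = 0 by rewrite ncZE mulr0.
have Zc (x : ncseries t4_letter) : t4_ideal (lie (t i1 i2 + t i1 i3 + t i2 i3) x) ->
    nc_closure Ut4_ideal (lie Z x).
  by move=> Jx; rewrite lieZl; apply: (idealZ I_closed); exact: Ut4_bracket.
have nil_Z (x : ncseries t4_letter) : lie_poly x -> (c *: x) [::] = 0.
  by move=> px; rewrite ncZE lie_poly_nil ?mulr0.
have [E1 E2 E3 E4 _] := cable_f1 c.
rewrite /pentagon !cableM !cable_exp // E1 E2 E3 E4.
have lhs := @move_exp _ _ g^{s01, s2, s3} g^{s0, s1, s23} (c *: t i2 i3)
  (c *: (t i1 i2 + t i1 i3)) I_closed.
have rhs := @move_exp _ _ g^{s0, s1, s2} g^{s0, s12, s3} (c *: t i1 i2)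
  (c *: (t i1 i3 + t i2 i3)) I_closed.
have sumL : c *: t i2 i3 + c *: (t i1 i2 + t i1 i3) = Z by rewrite -scalerDr addrC.
have sumR : c *: t i1 i2 + c *: (t i1 i3 + t i2 i3) = Z by rewrite -scalerDr addrA.
rewrite sumL in lhs; rewrite sumR in rhs.
apply: (ideal_trans I_closed (lhs _ _ _ _)).
- by apply: nil_Z; lie_poly_t.
- by apply: nil_Z; lie_poly_t.
- rewrite lieZl; apply: (idealZ I_closed); rewrite cableE; apply: commute_pair; try by lie_poly_t.
    rewrite lieC; apply: (idealN I_closed); apply: Ut4_bracket.
    exact: bracket_t01_t23.
  by apply: Ut4_bracket; exact: (t4_triple23 uniq123).
- by rewrite lieZl lieZr; do 2!apply: (idealZ I_closed);
    apply: Ut4_bracket; exact: (t4_triple23 uniq123).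
apply: (ideal_sym I_closed).
have {}rhs : nc_closure Ut4_ideal (g^{s0, s1, s2} * ncexp (c *: t i1 i2) *
    (g^{s0, s12, s3} * ncexp (c *: (t i1 i3 + t i2 i3))) -
    g^{s0, s1, s2} * g^{s0, s12, s3} * ncexp Z).
  apply: rhs.
  - by apply: nil_Z; lie_poly_t.
  - by apply: nil_Z; lie_poly_t.
  - rewrite lieZl; apply: (idealZ I_closed); rewrite cableE; apply: commute_pair; try by lie_poly_t.
      by apply: Ut4_bracket; exact: (t4_triple23 uniq012).
    by apply: Ut4_bracket; exact: (t4_triple12 uniq123).
  - by rewrite lieZl lieZr; do 2!apply: (idealZ I_closed);
      apply: Ut4_bracket; exact: (t4_triple12 uniq123).
have := idealMr I_closed h^{s1, s2, s3} rhs; rewrite mulrBl => {}rhs.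
apply: (ideal_trans I_closed rhs).
apply: (@ideal_trans _ _ I_closed (g^{s0, s1, s2} * g^{s0, s12, s3} *
   (h^{s1, s2, s3} * ncexp Z))).
  rewrite -!mulrA -!mulrBr; do 2!apply: (idealMl I_closed).
  rewrite -opprB; apply: (idealN I_closed).
  have Z_nil : Z [::] = 0 by apply: nil_Z; lie_poly_t.
  apply: (subalg_ncexp (centralizer_closed I_closed _)) => //.
  rewrite lieC; apply: (idealN I_closed).
  rewrite cableE; apply: commute_pair; try by lie_poly_t.
    apply: Zc; have := lie_idealN t4_lie_ideal (t4_triple12 uniq123).
    congr t4_ideal; rewrite -addrA lieDl liexx add0r [RHS]lieC; nc_linear.
  apply: Zc; have := lie_idealN t4_lie_ideal (t4_triple23 uniq123).
  congr t4_ideal; rewrite [in RHS]lieDl liexx addr0 [RHS]lieC; nc_linear.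
rewrite [X in X - _]mulrA -mulrBl; apply: (idealMr I_closed).
exact: (ideal_sym I_closed).
Qed.

Lemma lie_pentagon_add c alpha beta :
  lie_pentagon alpha beta -> lie_pentagon (alpha + c *: f1) beta.
Proof.
have [E1 E2 E3 E4 _] := cable_f1 c.
have cableD S0 S1 S2 (f g : ncseries bool) :
    (f + g)^{S0, S1, S2} = f^{S0, S1, S2} + g^{S0, S1, S2} by exact: ncsubstD.
rewrite /lie_pentagon !cableD E1 E2 E3 E4; congr nc_closure; nc_linear.
Qed.

(** * Projections of the pentagon *)

(** A substitution killing the defining relations is defined on the completed
    enveloping algebra, by continuity. *)
Lemma Ut4_closure_ker B (r : t4_letter -> ncseries B) x :
  (forall a, r a [::] = 0) -> (forall y, t4_relator y -> ncsubst r y = 0) ->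
  nc_closure Ut4_ideal x -> ncsubst r x = 0.
Proof.
move=> r0 rel /nc_closureP Ix; have ker := closed_ideal_ker r0.
apply: (ideal_lim ker) => n; have [y Iy xy] := Ix n; exists y => // {xy}.
elim: Iy => [|a z b /rel rz|z z' _ IH _ IH'].
- exact: ncsubst0.
- by rewrite !ncsubstM // rz mulr0 mul0r.
- by rewrite ncsubstD IH IH' addr0.
Qed.

(** Deletion of strand 0, followed by the projection of the algebra of strands
    1, 2, 3 along its centre, spanned by [t12 + t13 + t23]. The quotient is the
    free algebra on [t12] and [t23], whence the value at [t13]. *)
Definition delete0 (a : t4_letter) : ncseries bool :=
  match val a.1, val a.2 with
  | 1%N, 2%N | 2%N, 1%N => f0
  | 2%N, 3%N | 3%N, 2%N => f1
  | 1%N, 3%N | 3%N, 1%N => - f0 - f1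
  | _, _ => 0
  end.

Definition keep01 (a : t4_letter) : ncseries bool :=
  match val a.1, val a.2 with
  | 0%N, 1%N | 1%N, 0%N => f0
  | _, _ => 0
  end.

Lemma delete0_nil a : delete0 a [::] = 0.
Proof. by case: a => [[[|[|[|[|?]]]] ?] [[|[|[|[|?]]]] ?]]. Qed.

Lemma keep01_nil a : keep01 a [::] = 0.
Proof. by case: a => [[[|[|[|[|?]]]] ?] [[|[|[|[|?]]]] ?]]. Qed.

Lemma delete0_relator y : t4_relator y -> ncsubst delete0 y = 0.
Proof.
have sub_t a b : ncsubst delete0 (t a b) = delete0 (a, b).
  by rewrite ncsubst_letter //; exact: delete0_nil.
have flie := ncsubst_lie delete0_nil.
case=> [i|i j|i j k|i j k l].
- by rewrite sub_t; case: i => [[|[|[|[|?]]]] ?].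
- rewrite ncsubstB !sub_t.
  by case: i => [[|[|[|[|?]]]] ?]; case: j => [[|[|[|[|?]]]] ?]; rewrite /= subrr.
- rewrite flie ncsubstD !sub_t.
  case: i => [[|[|[|[|?]]]] ?] //; case: j => [[|[|[|[|?]]]] ?] //;
  case: k => [[|[|[|[|?]]]] ?] //= _; rewrite /delete0 /=;
  rewrite ?(lieDl, lieDr, lieNl, lieNr, liexx, lie0l, lie0r) ?[lie f1 f0]lieC;
  nc_linear.
- rewrite flie !sub_t.
  case: i => [[|[|[|[|?]]]] ?] //; case: j => [[|[|[|[|?]]]] ?] //;
  case: k => [[|[|[|[|?]]]] ?] //; case: l => [[|[|[|[|?]]]] ?] //= _;
  by rewrite /delete0 /= ?(lie0l, lie0r).
Qed.

Lemma keep01_relator y : t4_relator y -> ncsubst keep01 y = 0.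
Proof.
have sub_t a b : ncsubst keep01 (t a b) = keep01 (a, b).
  by rewrite ncsubst_letter //; exact: keep01_nil.
have comm a b c d : lie (keep01 (a, b)) (keep01 (c, d)) = 0.
  have keepE p q : keep01 (p, q) = 0 \/ keep01 (p, q) = f0.
    by case: p => [[|[|[|[|?]]]] ?]; case: q => [[|[|[|[|?]]]] ?]; rewrite /keep01 /=;
      auto.
  by case: (keepE a b) => ->; case: (keepE c d) => ->; rewrite ?lie0l ?lie0r ?liexx.
have flie := ncsubst_lie keep01_nil.
case=> [i|i j|i j k _|i j k l _].
- by rewrite sub_t; case: i => [[|[|[|[|?]]]] ?].
- rewrite ncsubstB !sub_t.
  by case: i => [[|[|[|[|?]]]] ?]; case: j => [[|[|[|[|?]]]] ?]; rewrite /= subrr.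
- by rewrite flie ncsubstD !sub_t lieDr !comm addr0.
- by rewrite flie !sub_t comm.
Qed.

Lemma lie_series_pair B (x y : ncseries B) alpha : lie_series alpha ->
  x [::] = 0 -> y [::] = 0 -> lie x y = 0 ->
  ncsubst (pair_letters x y) alpha =
    alpha [:: false] *: x + alpha [:: true] *: y.
Proof.
move=> sa x0 y0 xy; rewrite (lie_series_abelian sa); first by rewrite big_bool addrC.
  exact: pair_letters_nil.
by case=> -[] /=; rewrite ?liexx // lieC xy oppr0.
Qed.

Lemma grouplike_pair B (x y : ncseries B) g : grouplike g ->
  x [::] = 0 -> y [::] = 0 -> lie x y = 0 ->
  ncsubst (pair_letters x y) g = ncexp (g [:: false] *: x + g [:: true] *: y).
Proof.
move=> gg x0 y0 xy; have [sa Eg] := grouplike_exp gg.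
move: (nclog g) sa Eg => alpha sa ->.
rewrite ncsubst_exp; last 2 first.
- exact: pair_letters_nil.
- exact: lie_series_nil.
by rewrite (lie_series_pair sa) // !ncexp_letter.
Qed.

Lemma ncsubst_pair_id g : ncsubst (pair_letters f0 f1) g = g.
Proof.
rewrite -[RHS]ncsubst_id; congr ncsubst.
by apply: funext => -[].
Qed.

Lemma ncexpNr A (x : ncseries A) : x [::] = 0 -> ncexp x * ncexp (- x) = 1.
Proof.
move=> x0; have Nx0 : (- x) [::] = 0 by rewrite ncNE x0 oppr0.
have xx : lie x (- x) = 0 by rewrite lieNr liexx oppr0.
have := ncexpD (closed_ideal_zero A) x0 Nx0 xx.
by rewrite subrr ncexp0 => /subr0_eq <-.
Qed.

Lemma delete0_t : [/\ ncsubst delete0 (t i0 i1) = 0, ncsubst delete0 (t i0 i2) = 0,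
  ncsubst delete0 (t i1 i2) = f0, ncsubst delete0 (t i2 i3) = f1 &
  ncsubst delete0 (t i1 i3) = - f0 - f1].
Proof.
by split; rewrite ncsubst_letter /delete0 /= ?inordK //; exact: delete0_nil.
Qed.

Lemma keep01_t : [/\ ncsubst keep01 (t i0 i1) = f0, ncsubst keep01 (t i0 i2) = 0,
  ncsubst keep01 (t i1 i2) = 0, ncsubst keep01 (t i2 i3) = 0 &
  ncsubst keep01 (t i1 i3) = 0].
Proof.
by split; rewrite ncsubst_letter /keep01 /= ?inordK //; exact: keep01_nil.
Qed.

Lemma delete0_cables f :
  [/\ ncsubst delete0 f^{s01, s2, s3} = f,
      ncsubst delete0 f^{s0, s1, s23} = ncsubst (pair_letters 0 (- f1)) f,
      ncsubst delete0 f^{s0, s1, s2} = ncsubst (pair_letters 0 f0) f,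
      ncsubst delete0 f^{s0, s12, s3} = ncsubst (pair_letters 0 (- f0)) f &
      ncsubst delete0 f^{s1, s2, s3} = f].
Proof.
have [E01 E02 E12 E23 E13] := delete0_t.
split; rewrite !cableE ncsubst_pair ?ncsubstD ?E01 ?E02 ?E12 ?E23 ?E13 //;
  try exact: delete0_nil.
- by rewrite add0r ncsubst_pair_id.
- by rewrite addrA subrr sub0r.
- by rewrite addr0 subrK.
- by rewrite ncsubst_pair_id.
Qed.

Lemma keep01_cables f :
  [/\ ncsubst keep01 f^{s01, s2, s3} = ncsubst (pair_letters 0 0) f,
      ncsubst keep01 f^{s0, s1, s23} = ncsubst (pair_letters f0 0) f,
      ncsubst keep01 f^{s0, s1, s2} = ncsubst (pair_letters f0 0) f,
      ncsubst keep01 f^{s0, s12, s3} = ncsubst (pair_letters f0 0) f &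
      ncsubst keep01 f^{s1, s2, s3} = ncsubst (pair_letters 0 0) f].
Proof.
have [E01 E02 E12 E23 E13] := keep01_t.
by split; rewrite !cableE ncsubst_pair ?ncsubstD ?E01 ?E02 ?E12 ?E23 ?E13 ?addr0 //;
  exact: keep01_nil.
Qed.

(** Deleting strand 0 leaves [g * exp (- b f1)] on the left, and on the right
    [exp (b f0) * exp (- b f0) * h], where b is the coefficient of [f1] in g. *)
Lemma pentagon_delete0 g h : grouplike g -> pentagon g h ->
  h = g * ncexp (- g [:: true] *: f1).
Proof.
move=> gg pent.
have := Ut4_closure_ker delete0_nil delete0_relator pent.
have [E1 E2 E3 E4 _] := delete0_cables g; have [_ _ _ _ E5] := delete0_cables h.
have nilN (x : ncseries bool) : x [::] = 0 -> (- x) [::] = 0.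
  by move=> x0; rewrite ncNE x0 oppr0.
rewrite ncsubstB !ncsubstM; try exact: delete0_nil.
rewrite E1 E2 E3 E4 E5 !grouplike_pair ?lie0l ?nilN //.
rewrite !scaler0 !add0r !scalerN ncexpNr ?ncZE ?mulr0 // mul1r scaleNr.
by move/subr0_eq.
Qed.

Lemma lie_pentagon_delete0 alpha beta : lie_series alpha ->
  lie_pentagon alpha beta -> beta = alpha - alpha [:: true] *: f1.
Proof.
move=> sa pent.
have := Ut4_closure_ker delete0_nil delete0_relator (t4_closure_sub pent).
have [E1 E2 E3 E4 _] := delete0_cables alpha; have [_ _ _ _ E5] := delete0_cables beta.
have nilN (x : ncseries bool) : x [::] = 0 -> (- x) [::] = 0.
  by move=> x0; rewrite ncNE x0 oppr0.
rewrite ncsubstB !ncsubstD E1 E2 E3 E4 E5 !lie_series_pair ?lie0l ?nilN //.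
by rewrite !scaler0 !add0r !scalerN subrr add0r => /subr0_eq.
Qed.

(** Deleting strand 0 gives [phi * exp (- b f1) = phi], and keeping only [t01]
    gives [exp (a f0) = exp (a f0) * exp (a f0)], for a and b the coefficients of
    [f0] and [f1]. *)
Lemma pentagon_linear phi : grouplike phi -> pentagon phi phi ->
  phi [:: false] = 0 /\ phi [:: true] = 0.
Proof.
move=> gphi pent; have phi1 : phi [::] = 1 by case: gphi.
have f1E : f1 [:: true] = 1 by [].
have f0E : f0 [:: false] = 1 by [].
split.
  have := Ut4_closure_ker keep01_nil keep01_relator pent.
  have [E1 E2 E3 E4 E5] := keep01_cables phi.
  rewrite ncsubstB !ncsubstM; try exact: keep01_nil.
  rewrite E1 E2 E3 E4 E5 !grouplike_pair ?lie0l ?lie0r //.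
  rewrite !scaler0 !addr0 ncexp0 mul1r mulr1.
  move/(congr1 (fun f : ncseries bool => f [:: false])).
  rewrite ncBE ncM_letter !ncexp_nil !ncexp_letter ncZE f0E nc0E; lra.
have := congr1 (fun f : ncseries bool => f [:: true]) (pentagon_delete0 gphi pent).
rewrite ncM_letter phi1 ncexp_nil ncexp_letter ncZE f1E; lra.
Qed.

Lemma lie_pentagon_linear psi : lie_series psi -> lie_pentagon psi psi ->
  psi [:: false] = 0 /\ psi [:: true] = 0.
Proof.
move=> spsi pent.
have f1E : f1 [:: true] = 1 by [].
have f0E : f0 [:: false] = 1 by [].
split.
  have := Ut4_closure_ker keep01_nil keep01_relator (t4_closure_sub pent).
  have [E1 E2 E3 E4 E5] := keep01_cables psi.
  rewrite ncsubstB !ncsubstD E1 E2 E3 E4 E5 !lie_series_pair ?lie0l ?lie0r //.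
  rewrite !scaler0 !addr0 add0r.
  move/(congr1 (fun f : ncseries bool => f [:: false])).
  rewrite !ncE f0E; lra.
have := congr1 (fun f : ncseries bool => f [:: true]) (lie_pentagon_delete0 spsi pent).
rewrite !ncE f1E; lra.
Qed.

(** * Associators and solutions of the two equations *)

Lemma ASTR_E phi : ASTR phi <-> grouplike phi /\ pentagon phi phi.
Proof. by split=> -[gphi /eq_mod_Ut4]. Qed.

Lemma grt1_E psi : grt1 psi <-> lie_series psi /\ lie_pentagon psi psi.
Proof. by split=> -[spsi /eq_mod_t4]. Qed.

Lemma primitiveZ_f1 c : primitive (c *: f1).
Proof. by apply: primitiveZ; exact: primitive_letter. Qed.

Lemma expf1_grouplike c : grouplike (ncexp (c *: f1)).
Proof. by apply: ncexp_grouplike; [exact: primitiveZ_f1 | rewrite ncZE mulr0]. Qed.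

Lemma grouplike_commutator phi : grouplike phi ->
  phi [:: false] = 0 -> phi [:: true] = 0 -> commutator_grouplike phi.
Proof.
move=> gphi; have [sphi E] := grouplike_exp gphi.
move: (nclog phi) sphi E => alpha salpha ->; rewrite !ncexp_letter => a0 a1.
by exists alpha => //; exact: lie_series_commutator.
Qed.

Lemma ASTR_exp_set :
  [set phi * ncexp (c *: f1) | phi in ASTR & c in [set: rat]] =
  [set g | exp_f2_hat_dagger g /\
           exists2 h, commutator_grouplike h & pentagon g h].
Proof.
apply/seteqP; split=> [_ [phi /ASTR_E[gphi pent] [c _ <-]]|g [[gg g0] [h _ pent]]].
  have [phi0 phi1] := pentagon_linear gphi pent; split; last first.
    by exists phi; [exact: grouplike_commutator | exact: pentagon_exp].
  split; first by apply: grouplikeM => //; exact: expf1_grouplike.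
  by rewrite ncM_letter ncexp_letter phi0 mul0r addr0 ncZE mulr0 mulr0.
(* The coefficient of f1 in g is the one that phi must lose. *)
pose b := g [:: true]; pose phi := g * ncexp (- b *: f1).
have hE : h = phi by exact: pentagon_delete0.
exists phi.
  apply/ASTR_E; split; last by rewrite -{2}hE; exact: pentagon_exp.
  by apply: grouplikeM => //; exact: expf1_grouplike.
exists b => //; rewrite /phi -mulrA scaleNr.
have := @ncexpNr _ (- (b *: f1)); rewrite opprK ncNE ncZE mulr0 oppr0 => -> //.
by rewrite mulr1.
Qed.

Lemma grt1_add_set :
  [set psi + c *: f1 | psi in grt1 & c in [set: rat]] =
  [set alpha | f2_hat_dagger alpha /\
               exists2 beta, commutator_lielike beta & lie_pentagon alpha beta].
Proof.
have cf1 c : lie_series (c *: f1).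
  by apply: lie_poly_series; apply: LiePolyZ; exact: LiePolyLetter.
apply/seteqP; split=> [_ [psi /grt1_E[spsi pent] [c _ <-]]|alpha [[sa a0] [beta _ pent]]].
  have [psi0 psi1] := lie_pentagon_linear spsi pent; split; last first.
    by exists psi; [exact: lie_series_commutator | exact: lie_pentagon_add].
  by split; [exact: lie_seriesD | rewrite ncDE psi0 ncZE mulr0 addr0].
pose b := alpha [:: true]; have betaE := lie_pentagon_delete0 sa pent.
have psiE : alpha + (- b) *: f1 = beta by rewrite betaE scaleNr.
exists (alpha + (- b) *: f1); last by exists b => //; rewrite scaleNr subrK.
apply/grt1_E; split; first exact: lie_seriesD.
by rewrite {2}psiE; exact: lie_pentagon_add.
Qed.

Lemma flip_equation_grouplike g h : exp_f2_hat_dagger g ->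
  nc_closure Ut4_ideal (flip (g^{s0, s1, s2} * g^{s0, s12, s3}) -
    g^{s0, s1, s2} * g^{s0, s12, s3} * h^{s1, s2, s3}) <-> pentagon g h.
Proof.
move=> /flip_cables_grouplike E; have cI := Ut4_closed.
split; first exact: (ideal_trans cI (ideal_sym cI E)).
exact: (ideal_trans cI E).
Qed.

Lemma t4_closure_trans y x z : nc_closure t4_ideal (x - y) ->
  nc_closure t4_ideal (y - z) -> nc_closure t4_ideal (x - z).
Proof.
by move=> /eq_mod_t4 xy /eq_mod_t4 yz; apply/eq_mod_t4; rewrite xy.
Qed.

Lemma flip_equation_lie alpha beta : f2_hat_dagger alpha ->
  nc_closure t4_ideal (flip (alpha^{s0, s1, s2} + alpha^{s0, s12, s3}) -
    (alpha^{s0, s1, s2} + alpha^{s0, s12, s3} + beta^{s1, s2, s3})) <->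
  lie_pentagon alpha beta.
Proof.
move=> /flip_cables_lie E; split; apply: t4_closure_trans => //.
by apply/eq_mod_t4/esym/eq_mod_t4.
Qed.

Theorem theorem78 :
  (* (1) *)
  [/\ [set phi * ncexp (c *: f1) | phi in ASTR & c in [set: rat]] =
      [set g | exp_f2_hat_dagger g /\
         exists2 h, commutator_grouplike h &
           flip (g^{s0, s1, s2} * g^{s0, s12, s3})
           = g^{s0, s1, s2} * g^{s0, s12, s3} * h^{s1, s2, s3} %[mod Ut4_hat]],
      [set phi * ncexp (c *: f1) | phi in ASTR & c in [set: rat]] =
      [set g | exp_f2_hat_dagger g /\
         exists2 h, commutator_grouplike h &
           g^{s01, s2, s3} * g^{s0, s1, s23}
           = g^{s0, s1, s2} * g^{s0, s12, s3} * h^{s1, s2, s3} %[mod Ut4_hat]]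
    & forall g h, exp_f2_hat_dagger g -> commutator_grouplike h ->
        (flip (g^{s0, s1, s2} * g^{s0, s12, s3})
         = g^{s0, s1, s2} * g^{s0, s12, s3} * h^{s1, s2, s3} %[mod Ut4_hat])
        <->
        (g^{s01, s2, s3} * g^{s0, s1, s23}
         = g^{s0, s1, s2} * g^{s0, s12, s3} * h^{s1, s2, s3} %[mod Ut4_hat])]
  /\
  (* (2) *)
  [/\ [set psi + c *: f1 | psi in grt1 & c in [set: rat]] =
      [set alpha | f2_hat_dagger alpha /\
         exists2 beta, commutator_lielike beta &
           flip (alpha^{s0, s1, s2} + alpha^{s0, s12, s3})
           = alpha^{s0, s1, s2} + alpha^{s0, s12, s3} + beta^{s1, s2, s3}
             %[mod t4_hat]],
      [set psi + c *: f1 | psi in grt1 & c in [set: rat]] =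
      [set alpha | f2_hat_dagger alpha /\
         exists2 beta, commutator_lielike beta &
           alpha^{s01, s2, s3} + alpha^{s0, s1, s23}
           = alpha^{s0, s1, s2} + alpha^{s0, s12, s3} + beta^{s1, s2, s3}
             %[mod t4_hat]]
    & forall alpha beta, f2_hat_dagger alpha -> commutator_lielike beta ->
        (flip (alpha^{s0, s1, s2} + alpha^{s0, s12, s3})
         = alpha^{s0, s1, s2} + alpha^{s0, s12, s3} + beta^{s1, s2, s3}
           %[mod t4_hat])
        <->
        (alpha^{s01, s2, s3} + alpha^{s0, s1, s23}
         = alpha^{s0, s1, s2} + alpha^{s0, s12, s3} + beta^{s1, s2, s3}
           %[mod t4_hat])].
Proof.
have flipG g h : exp_f2_hat_dagger g ->
    (flip (g^{s0, s1, s2} * g^{s0, s12, s3})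
     = g^{s0, s1, s2} * g^{s0, s12, s3} * h^{s1, s2, s3} %[mod Ut4_hat]) <->
    pentagon g h.
  by move=> /flip_equation_grouplike E; rewrite -E eq_mod_Ut4.
have flipL alpha beta : f2_hat_dagger alpha ->
    (flip (alpha^{s0, s1, s2} + alpha^{s0, s12, s3})
     = alpha^{s0, s1, s2} + alpha^{s0, s12, s3} + beta^{s1, s2, s3} %[mod t4_hat])
    <-> lie_pentagon alpha beta.
  by move=> /flip_equation_lie E; rewrite -E eq_mod_t4.
split; split.
- rewrite ASTR_exp_set; apply/seteqP; split=> g [dg [h ch P]];
  by split=> //; exists h => //; apply/flipG.
- rewrite ASTR_exp_set; apply/seteqP; split=> g [dg [h ch P]];
  by split=> //; exists h => //; apply/eq_mod_Ut4.
- by move=> g h dg _; rewrite flipG // eq_mod_Ut4.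
- rewrite grt1_add_set; apply/seteqP; split=> a [da [b cb P]];
  by split=> //; exists b => //; apply/flipL.
- rewrite grt1_add_set; apply/seteqP; split=> a [da [b cb P]];
  by split=> //; exists b => //; apply/eq_mod_t4.
- by move=> a b da _; rewrite flipL // eq_mod_t4.
Qed.
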